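(* Let $n\ge1$, let $q_k$ ($k=1,\dots,n$) be real valued locally integrable functions on $[t_0;+\infty)$, let $\alpha_k$ ($k=1,\dots,n$) be real valued measurable locally bounded functions on $[t_0;+\infty)$, and let $p$ be a positive function on $[t_0;+\infty)$ with $1/p$ locally integrable on $[t_0;+\infty)$. Suppose that $q_k(t)\ge0$ for $t\ge t_0$ and $\lim_{t\to+\infty}\alpha_k(t)=+\infty$, $k=1,\dots,n$. Let $\Omega_+$ be the set of those $k\in\{1,\dots,n\}$ for which there is $t_k\ge t_0$ with $\alpha_k(t)\ge t$ for all $t\ge t_k$, and let $\Omega_-$ be the set of those $k\in\{1,\dots,n\}$ for which there is $t_k\ge t_0$ with $\alpha_k(t)\le t$ for all $t\ge t_k$. Suppose $\Omega_+\ne\emptyset$, $\Omega_-\neq\emptyset$, and $$\int_{t_0}^{+\infty}\Bigl[\sum_{k\in\Omega_+}q_k(\tau)\Bigr]d\tau<+\infty.$$ If the ordinary differential equations $$(p(t)\phi'(t))'+\Bigl[\sum_{k\in\Omega_-}q_k(t)\Bigr]\phi(t)=0$$ and $$(p(t)\phi'(t))'+\Biggl[\sum_{k\in\Omega_+}q_k(t)\exp\Bigl\{\int_t^{\alpha_k(t)}\frac{1}{p(\tau)}\Bigl(\int_\tau^{+\infty}\sum_{j\in\Omega_+}q_j(s)\,ds\Bigr)d\tau\Bigr\}\Biggr]\phi(t)=0$$ are oscillatory, then the equation $$(p(t)\phi'(t))'+\sum_{k=1}^n q_k(t)\phi(\alpha_k(t))=0,\qquad t\ge t_0,$$ is also 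oscillatory.
   Context: Let $T_0=\min\{t_0,\ \inf_{t\ge t_0,\,1\le k\le n}\alpha_k(t)\}$. A solution of $(p\phi')'+\sum_k q_k(t)\phi(\alpha_k(t))=0$, $t\ge t_0$, is a real valued continuous function $\phi$ on $[T_0;+\infty)$ that is locally absolutely continuous on $[t_0;+\infty)$, such that $p\phi'$ is (after modification on a null set) locally absolutely continuous on $[t_0;+\infty)$, and such that the equation holds almost everywhere on $[t_0;+\infty)$; this equation is called oscillatory if each of its solutions has arbitrarily large zeros. For an ordinary differential equation $(p\phi')'+Q(t)\phi=0$ with $Q$ defined for all sufficiently large $t$, a solution is a function $\phi$ on some half-line $[T;+\infty)$ on which $Q$ is defined, with $\phi$ and $p\phi'$ locally absolutely continuous, satisfying the equation almost everywhere on $[T;+\infty)$; the equation is oscillatory if each of its solutions has arbitrarily large zeros. The integral $\int_\xi^\eta$ is taken in the direction from $\xi$ to $\eta$, i.e. $\int_\xi^\eta=-\int_\eta^\xi$ if $\eta<\xi$. *)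

(* Defs.v *)
From HB Require Import structures.
From mathcomp Require Import all_boot all_order all_algebra.
From mathcomp Require Import all_classical all_reals all_analysis.

Set Implicit Arguments.
Unset Strict Implicit.
Unset Printing Implicit Defensive.

Import Order.TTheory GRing.Theory Num.Theory.
Import numFieldNormedType.Exports.

Local Open Scope classical_set_scope.
Local Open Scope ring_scope.

(* "Measurable", "integrable" and "almost everywhere" refer to the completed
   Lebesgue measure, so that functions need only be Lebesgue measurable, not
   Borel. The type of its points, [lebesgueR R], is convertible to R. *)
Definition lebesgueR (R : realType) :=
  caratheodory_type ((@wlength R idfun)^*)%mu.

Notation leb R := (@completed_lebesgue_measure R).

Section Defs.
Context {R : realType}.
Implicit Types (f p Q phi psi : R -> R) (a b t T : R).

Definition lebesgue_measurable_fun (D : set R) f :=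
  @measurable_fun _ _ (lebesgueR R) (measurableTypeR R) D f.

Definition locally_integrable_from T f :=
  forall b, (leb R).-integrable `[T, b] (EFin \o f).

Definition locally_bounded_from T f :=
  forall b, [bounded f t | t in `[T, b]].

Definition oriented_integral a b f : R :=
  if a <= b then \int[leb R]_(t in `[a, b]) f t
  else - \int[leb R]_(t in `[b, a]) f t.

Definition absolutely_continuous a b f :=
  forall e : R, 0 < e -> exists2 d : R, 0 < d &
    forall (m : nat) (x y : 'I_m -> R),
      (forall i, [/\ a <= x i, x i <= y i & y i <= b]) ->
      trivIset setT (fun i => `]x i, y i[%classic) ->
      \sum_(i < m) (y i - x i) < d ->
      \sum_(i < m) `|f (y i) - f (x i)| < e.

Definition locally_absolutely_continuous_from T f :=
  forall b, absolutely_continuous T b f.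

(* (p phi')' + F = 0 almost everywhere on [T, +oo[, where psi is the locally
   absolutely continuous representative of p phi'. *)
Definition satisfies_from T p phi (F : R -> R) :=
  exists psi,
    [/\ locally_absolutely_continuous_from T psi,
        {ae leb R, forall t : R, T <= t ->
          derivable phi t 1 /\ p t * derive1 phi t = psi t}
      & {ae leb R, forall t : R, T <= t ->
          derivable psi t 1 /\ derive1 psi t + F t = 0}].

Definition arbitrarily_large_zeros T phi :=
  forall M : R, exists t, [/\ T <= t, M <= t & phi t = 0].

(* D is the set on which the coefficient Q is defined. *)
Definition ode_solution (D : set R) p Q T phi :=
  [/\ `[T, +oo[ `<=` D,
      locally_absolutely_continuous_from T phi
    & satisfies_from T p phi (fun t => Q t * phi t)].

Definition ode_oscillatory (D : set R) p Q :=
  forall T phi, ode_solution D p Q T phi -> arbitrarily_large_zeros T phi.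

Section Deviating.
Variables (n : nat) (t0 : R) (q alpha : 'I_n -> R -> R).

Definition initial_point : R :=
  Num.min t0 (inf [set s | exists k t, t0 <= t /\ s = alpha k t]).

Definition deviating_solution p phi :=
  [/\ {within `[initial_point, +oo[, continuous phi},
      locally_absolutely_continuous_from t0 phi
    & satisfies_from t0 p phi (fun t => \sum_(k < n) q k t * phi (alpha k t))].

Definition deviating_oscillatory p :=
  forall phi, deviating_solution p phi ->
    arbitrarily_large_zeros initial_point phi.

Definition Omega_plus : set 'I_n :=
  [set k | exists2 tk, t0 <= tk & forall t, tk <= t -> t <= alpha k t].

Definition Omega_minus : set 'I_n :=
  [set k | exists2 tk, t0 <= tk & forall t, tk <= t -> alpha k t <= t].

Definition q_minus t : R := \sum_(k in Omega_minus) q k t.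

Definition q_plus t : R := \sum_(k in Omega_plus) q k t.

Definition q_plus_exp p t : R :=
  \sum_(k in Omega_plus) q k t *
    expR (oriented_integral t (alpha k t) (fun tau =>
      1 / p tau * \int[leb R]_(s in `[tau, +oo[) q_plus s)).

(* p and the q_k are only given on [t0, +oo[, hence the condition on alpha. *)
Definition q_plus_exp_dom : set R :=
  [set t | t0 <= t /\ forall k, k \in Omega_plus -> t0 <= alpha k t].

End Deviating.
End Defs.

(* Main.v *)
Require Import Defs.
From HB Require Import structures.
From mathcomp Require Import all_boot all_order all_algebra.
From mathcomp Require Import all_classical all_reals all_analysis.
From mathcomp Require Import measurable_realfun lra.

Set Implicit Arguments.
Unset Strict Implicit.
Unset Printing Implicit Defensive.

Import Order.TTheory GRing.Theory Num.Theory.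
Import numFieldNormedType.Exports.

Local Open Scope classical_set_scope.
Local Open Scope ring_scope.

(** Suppose that the equation with deviating arguments has a solution [phi]
    without arbitrarily large zeros.  It keeps a sign, and since the equation is
    linear it may be taken positive near [+oo].  All delayed or advanced values
    [phi (alpha k t)] are then positive for large [t], so the flux
    [psi = p phi'] is nonincreasing near [+oo], and one of two things happens.

    If [psi] becomes negative, [phi] is nonincreasing from there on, so
    [phi (alpha k t) >= phi t] for [k] in [Omega_minus], and
    [psi' + q_minus phi <= 0].

    Otherwise [psi >= 0] and [phi] is nondecreasing.  Advanced values dominate
    [phi t], so integrating [psi' + q_plus phi <= 0] up to [+oo] gives
    [psi t >= phi t * \int_t^oo q_plus] ([tail_le_flux]).  This is a lower bound
    for the logarithmic derivative of [phi], hence by [ln_growth]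
    [phi (alpha k t) >= phi t * exp (\int_t^(alpha k t) 1/p \int q_plus)], and
    [psi' + q_plus_exp phi <= 0].

    In both cases one of the two ordinary equations has a positive
    supersolution.  It then has a positive solution ([positive_supersolution]),
    contrary to its being oscillatory.  The solution is found as a fixed point.
    Put [x = phi], [y = psi] if [psi >= 0], and [x = - psi], [y = phi] if
    [psi < 0].  In the two cases the supersolution inequalities read
      [x t >= x T + \int_T^t f y],  [y t >= \int_t^oo g x]
    with [x] nondecreasing and [f], [g] nonnegative ([1/p] and the coefficient,
    in one order or the other).  The right-hand sides are monotone in [(x, y)],
    so by Knaster and Tarski there is a pair [(u, v)] below [(x, y)] for which
    both are equalities ([exists_integral_system]), and this pair solves the
    differential equation.  Looking for [u] among the nondecreasing functions
    makes every function that occurs monotone, hence measurable, although the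
    fixed point is an infimum over an uncountable family.

    The rest is the passage between derivatives and integrals: an indefinite
    integral is absolutely continuous and differentiable almost everywhere
    ([primitive_ac], [primitive_derivable]), and an absolutely continuous
    function with a nonnegative derivative almost everywhere is nondecreasing
    ([absolutely_continuous_le]). *)

(** * Completed and Borel Lebesgue measure *)

Section CompletedLebesgue.
Context {R : realType}.
Local Notation mu := (@lebesgue_measure R).
(* [B] and [L] are the real line with its Borel and with its Lebesgue measurable
   sets; the two types are convertible, so the intended one is often given. *)
Local Notation B := (measurableTypeR R).
Local Notation L := (lebesgueR R).

Lemma leb_measurable_borel (A : set R) :
  (@measurable _ B A) -> (@measurable _ L A).
Proof. by move=> mA; exact: sub_caratheodory. Qed.

Lemma leb_measurableP (A : set R) : @measurable _ L A ->
  exists2 C : set R, @measurable _ B C & exists2 N : set R,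
    mu.-negligible N & A = C `|` N.
Proof.
move=> mA.
have : (completed_algebra_gen mu).-sigma.-measurable A.
  by rewrite completed_caratheodory_measurable.
rewrite g_sigma_completed_algebra_genE => -[C mC [N nN <-]].
by exists C => //; exists N.
Qed.

(** Every Lebesgue measurable set is a Borel set up to a null set, so completion
    creates no new negligible sets. *)
Lemma leb_negligibleP (A : set R) : (leb R).-negligible A <-> mu.-negligible A.
Proof.
split=> [[C [mC C0 AC]]|[C [mC C0 AC]]]; last first.
  by exists C; split => //; exact: leb_measurable_borel.
have [D mD [N nN CE]] := leb_measurableP mC.
apply: (@negligibleS _ B _ mu C A AC); rewrite CE; apply: negligibleU => //.
exists D; split => //; apply/eqP; rewrite eq_le measure_ge0 andbT -C0 CE.
apply: le_outer_measure; exact: subsetUl.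
Qed.

Lemma measurable_idfun_leb : @measurable_fun _ _ L B setT idfun.
Proof. by move=> _ Y mY; rewrite setTI; exact: leb_measurable_borel. Qed.

Lemma measurable_funT_leb d (T : measurableType d) (f : R -> T) :
  @measurable_fun _ _ B T setT f -> @measurable_fun _ _ L T setT f.
Proof.
move=> mf _ Y mY; apply: leb_measurable_borel; exact: mf.
Qed.

Lemma integral_leb_borel (D : set R) (g : R -> R) :
  @measurable _ B D -> @measurable_fun _ _ B B setT g ->
  (\int[leb R]_(x in D) (g x)%:E = \int[mu]_(x in D) (g x)%:E)%E.
Proof.
move=> mD mg.
have ge0E (h : R -> \bar R) : (forall x, 0 <= h x)%E ->
    @measurable_fun _ _ B _ setT h ->
    (\int[leb R]_(x in D) h x = \int[mu]_(x in D) h x)%E.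
  move=> h0 mh.
  rewrite -(@ge0_integral_pushforward _ _ L B R idfun measurable_idfun_leb)//.
  exact: measurable_funTS.
rewrite integralE [RHS]integralE; congr (_ - _)%E; apply: ge0E => //.
- by apply/measurable_funepos/measurable_EFinP.
- by apply/measurable_funeneg/measurable_EFinP.
Qed.

(** Each superlevel set at a rational height is Borel up to a null set.  Cutting
    [f] off on one Borel null set that contains these countably many exceptional
    sets makes all superlevel sets Borel. *)
Lemma borel_representative (f : R -> R) : @measurable_fun _ _ L B setT f ->
  exists g : R -> R, @measurable_fun _ _ B B setT g /\
    {ae leb R, forall x : R, f x = g x}.
Proof.
move=> mf.
have mfr (r : rat) : @measurable _ L (f @^-1` `]ratr r, +oo[).
  by rewrite -[X in measurable X]setTI; apply: mf => //; exact: measurable_itv.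
have /choice[C /choice[N hCN]] : forall r : rat, exists C N : set R,
    [/\ @measurable _ B C, mu.-negligible N & f @^-1` `]ratr r, +oo[ = C `|` N].
  by move=> r; have [C mC [N nN E]] := leb_measurableP (mfr r); exists C, N.
have mC r : @measurable _ B (C r) by case: (hCN r).
have [M [mM M0 NM]] : mu.-negligible (\bigcup_r N r).
  rewrite (_ : \bigcup_r N r = \bigcup_n (oapp N set0 (unpickle n))).
    apply: negligible_bigcup => n; case: unpickle => [r|] /=.
      by case: (hCN r).
    exact: negligible_set0.
  apply/seteqP; split => [x [r _ Nx]|x [n _]].
    exists (pickle r); first by [].
    by rewrite pickleK.
  by case: unpickle => //= r Nx; exists r.
exists (f \_ (~` M)); split; last first.
  apply/leb_negligibleP; exists M; split => // x /= fx.
  by apply: contrapT => nMx; apply: fx; rewrite patchE mem_set.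
suff mg (r : rat) : @measurable _ B ((f \_ (~` M)) @^-1` `]ratr r, +oo[).
  apply: (measurability (@RGenOInfty.G R)) => [|/= _ [_] [x] -> <-].
    exact: RGenOInfty.measurableE.
  rewrite setTI (_ : _ @^-1` _ =
     \bigcup_(r in [set r : rat | x < ratr r]) ((f \_ (~` M)) @^-1` `]ratr r, +oo[)).
    by rewrite bigcup_mkcond; apply: bigcupT_measurable_rat => r; case: ifPn.
  apply/seteqP; split => y /=.
    rewrite in_itv/= andbT => /rat_in_itvoo[r]; rewrite in_itv/= => /andP[xr ry].
    by exists r => //=; rewrite in_itv/= ry.
  by move=> [r /= xr]; rewrite !in_itv/= !andbT => ry; exact: lt_trans ry.
rewrite (_ : _ @^-1` _ = (C r `&` ~` M) `|`
    (if (ratr r : R) < 0 then M else set0)).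
  apply: measurableU; last by case: ifPn.
  by apply: measurableI => //; exact: measurableC.
have nN x : ~ M x -> ~ N r x by move=> nM Nx; apply: nM; apply: NM; exists r.
have CN : f @^-1` `]ratr r, +oo[ = C r `|` N r by case: (hCN r).
apply/seteqP; split => x /=; rewrite in_itv/= andbT patchE.
  case: ifPn => [|/negP]; rewrite inE => Mx rx.
    left; split => //.
    have : (f @^-1` `]ratr r, +oo[) x by rewrite /= in_itv/= rx.
    by rewrite CN => -[//|/nN].
  by right; rewrite rx; exact: contrapT.
move=> [[Cx nM]|].
  rewrite mem_set//.
  have : (f @^-1` `]ratr r, +oo[) x by rewrite CN; left.
  by rewrite /= in_itv/= andbT.
by case: ifPn => // r0 Mx; rewrite memNset//=; exact.
Qed.

Lemma leb_measurable_itv (i : interval R) : @measurable _ L [set` i].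
Proof. by apply: leb_measurable_borel; exact: measurable_itv. Qed.

Lemma locally_integrable_from_itv (T b : R) f (D : set R) :
  locally_integrable_from T f -> @measurable _ B D -> D `<=` `[T, b] ->
  (leb R).-integrable D (EFin \o f).
Proof.
move=> fT mD DTb.
have mL : @measurable _ L [set` `[T, b]] := leb_measurable_itv _.
exact: (@integrableS _ L _ (leb R) _ D (EFin \o f) mL (leb_measurable_borel mD)).
Qed.

Lemma locally_integrable_fromS (T T' : R) f : T <= T' ->
  locally_integrable_from T f -> locally_integrable_from T' f.
Proof.
move=> TT' fT b; apply: (locally_integrable_from_itv (b := b) fT).
  exact: measurable_itv.
by move=> x /=; rewrite !in_itv/= => /andP[/(le_trans TT') -> ->].
Qed.

Lemma locally_integrable_from_measurable (T : R) f : locally_integrable_from T f ->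
  lebesgue_measurable_fun `[T, +oo[ f.
Proof.
move=> fT; rewrite /lebesgue_measurable_fun.
rewrite (_ : [set` `[T, +oo[] = \bigcup_(n : nat) [set` `[T, n%:R]]); last first.
  apply/seteqP; split => [x /=|x [n _] /=]; rewrite !in_itv/= ?andbT.
    move=> Tx; exists (Num.bound x) => //=; rewrite in_itv/= Tx/=.
    exact/ltW/unstable.ltr_bound.
  by case/andP.
apply/measurable_fun_bigcup => [n|n]; first exact: leb_measurable_itv.
by have /measurable_int/measurable_EFinP := fT n%:R.
Qed.

Lemma ae_lebS (P Q : R -> Prop) : (forall x, P x -> Q x) ->
  {ae leb R, forall x : R, P x} -> {ae leb R, forall x : R, Q x}.
Proof. exact: (@filterS _ _ (@ae_filter_ringOfSetsType _ L _ (leb R))). Qed.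

Lemma ae_lebI (P Q : R -> Prop) : {ae leb R, forall x : R, P x} ->
  {ae leb R, forall x : R, Q x} -> {ae leb R, forall x : R, P x /\ Q x}.
Proof. exact: (@filterI _ _ (@ae_filter_ringOfSetsType _ L _ (leb R))). Qed.

(** The differentiation theorem and the absolute continuity of the integral are
    used for Borel functions; replacing [f] by [g] transfers them to the completed
    measure. *)
Lemma locally_integrable_from_borel (T : R) f : locally_integrable_from T f ->
  exists g : R -> R, [/\ @measurable_fun _ _ B B setT g,
    {ae leb R, forall x : R, T <= x -> f x = g x},
    forall b, mu.-integrable `[T, b] (EFin \o g) &
    forall D : set R, @measurable _ B D -> D `<=` `[T, +oo[ ->
    (\int[leb R]_(x in D) (f x)%:E = \int[mu]_(x in D) (g x)%:E)%E].
Proof.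
move=> fT.
have mT : @measurable _ L [set` `[T, +oo[] := leb_measurable_itv _.
have mfT : @measurable_fun _ _ L B setT (f \_ `[T, +oo[).
  apply: (proj1 (@measurable_restrictT _ _ L B _ f mT)).
  exact: locally_integrable_from_measurable fT.
have [g [mg fg]] := borel_representative mfT.
have fg' : {ae leb R, forall x : R, T <= x -> f x = g x}.
  apply: ae_lebS fg => x + Tx; rewrite patchE mem_set// /= in_itv/= Tx//.
have fgD (h : R -> R) (D : set R) : @measurable_fun _ _ B B setT h ->
    @measurable _ B D -> D `<=` `[T, +oo[ ->
    (\int[leb R]_(x in D) (h (f x))%:E = \int[mu]_(x in D) (h (g x))%:E)%E.
  move=> mh mD DT; rewrite -integral_leb_borel//; last exact: measurableT_comp.
  apply: (@ae_eq_integral _ L R (leb R)).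
  - exact: leb_measurable_borel.
  - have mfD : @measurable_fun _ _ L B D f.
      exact: (@measurable_funS _ _ L B _ D f mT DT (locally_integrable_from_measurable fT)).
    apply/(@measurable_EFinP _ L).
    exact: (@measurableT_comp _ _ _ L B B h D f mh mfD).
  - apply/measurable_EFinP; apply: measurable_funTS.
    apply: measurable_funT_leb; exact: measurableT_comp.
  - apply: ae_lebS fg' => x fgx Dx; rewrite fgx//.
    by have := DT _ Dx; rewrite /= in_itv/= andbT.
exists g; split => //.
- move=> b; apply/integrableP; split.
    apply/measurable_EFinP; exact: measurable_funTS.
  rewrite -(fgD Num.norm)//; last first.
    by move=> x /=; rewrite !in_itv/= => /andP[->].
  by have /integrableP[] := fT b.
- move=> D mD DT; apply: (fgD idfun) => //; exact: measurable_id.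
Qed.

End CompletedLebesgue.

(** * Indefinite integrals *)

Section Primitive.
Context {R : realType}.
Local Notation mu := (@lebesgue_measure R).
Local Notation B := (measurableTypeR R).
Local Notation L := (lebesgueR R).
Implicit Types (f g : R -> R) (T a b s t x y : R).

Definition primitive T f t : R := \int[leb R]_(s in `[T, t]) f s.

Lemma primitiveB T f s t : locally_integrable_from T f -> T <= s -> s <= t ->
  primitive T f t - primitive T f s = primitive s f t.
Proof.
move=> fT Ts st; have [g [mg _ ig fg]] := locally_integrable_from_borel fT.
have E c d : T <= c -> (\int[leb R]_(x in `[c, d]) (f x)%:E =
    \int[mu]_(x in `[c, d]) (g x)%:E)%E.
  move=> Tc; apply: fg => [|x /=]; first exact: measurable_itv.
  by rewrite !in_itv/= andbT => /andP[cx _]; exact: le_trans cx.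
rewrite /primitive /Rintegral !E// -!/(Rintegral _ _ _).
rewrite Rintegral_itvB//; [|by rewrite bnd_simp..].
rewrite Rintegral_itv_obnd_cbnd//.
apply: integrableS (ig t) => // x /=.
by rewrite !in_itv/= => /andP[/ltW sx ->]; rewrite (le_trans Ts sx).
Qed.

Lemma measure_bigsetU_itv m (x y : 'I_m -> R) : (forall i, x i <= y i) ->
  trivIset setT (fun i => `]x i, y i[%classic) ->
  mu (\big[setU/set0]_(i < m) `]x i, y i[%classic) = (\sum_(i < m) (y i - x i))%:E.
Proof.
move=> xy tri.
have muI i : mu `]x i, y i[%classic = (y i - x i)%:E.
  rewrite lebesgue_measure_itv/= lte_fin lt_neqAle xy.
  by rewrite andbT -EFinB; case: eqVneq => [->|//]; rewrite subrr.
rewrite -sumEFin measure_bigsetU_ord//.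
by apply: eq_bigr => i _; exact: muI.
Qed.

Lemma primitive_ac T f : locally_integrable_from T f ->
  locally_absolutely_continuous_from T (primitive T f).
Proof.
move=> fT b e e0; have [g [mg _ ig fg]] := locally_integrable_from_borel fT.
have := ig b; rewrite integrable_mkcond// restrict_EFin => ifT.
have [d [d0 hd]] := integral_normr_continuous ifT e0.
exists d => // m x y xyb tri xyd.
have xyi i : x i <= y i by have [] := xyb i.
have Txi i : T <= x i by have [] := xyb i.
have yib i : y i <= b by have [] := xyb i.
pose D : set R := \big[setU/set0]_(i < m) `]x i, y i[%classic.
have mD : measurable D by apply: bigsetU_measurable => i _.
have muD : mu D = (\sum_(i < m) (y i - x i))%:E by exact: measure_bigsetU_itv.
have /(hd D mD) : (mu D < d%:E)%E by rewrite muD lte_fin.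
apply: le_lt_trans.
have subT i : `]x i, y i[ `<=` `[T, b].
  move=> z /=; rewrite !in_itv/= => /andP[xz zy].
  by rewrite (le_trans (Txi i) (ltW xz)) (le_trans (ltW zy)).
have igxy i : mu.-integrable `]x i, y i[ (EFin \o g).
  by apply: integrableS (ig b).
have IE i : (\int[mu]_(s in `]x i, y i[) `|(g \_ `[T, b]) s|%:E =
    (\int[mu]_(s in `]x i, y i[) `|g s|)%:E)%E.
  rewrite /Rintegral fineK; last first.
    by apply: integrable_fin_num => //; exact: integrable_norm (igxy i).
  apply: eq_integral => z; rewrite inE => zxy.
  by rewrite patchE mem_set//; exact: subT zxy.
rewrite {1}/Rintegral ge0_integral_bigsetU//=; first last.
- apply: measurable_funTS; apply/measurable_EFinP; apply: measurableT_comp => //.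
  by have /measurable_int/measurable_EFinP := ifT.
- by apply: sub_trivIset tri => // i.
- exact: index_enum_uniq.
rewrite (eq_bigr _ (fun i _ => IE i)).
rewrite sumEFin/=; apply: ler_sum => i _.
rewrite (primitiveB fT)// /primitive.
have -> : \int[leb R]_(s in `[x i, y i]) f s = \int[mu]_(s in `]x i, y i[) g s.
  rewrite /Rintegral fg//.
    rewrite -integral_itv_bndo_bndc ?integral_itv_obnd_cbnd//.
    - by apply: measurable_funTS; apply/measurable_EFinP.
    - by apply: measurable_funTS; apply/measurable_EFinP.
  move=> z /=; rewrite !in_itv/= => /andP[xz _].
  by rewrite andbT (le_trans (Txi i)).
exact: le_normr_Rintegral.
Qed.

(** Lebesgue's differentiation theorem, applied to a Borel representative. *)
Lemma primitive_derivable T f : locally_integrable_from T f ->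
  {ae leb R, forall t, T < t ->
     derivable (primitive T f) t 1 /\ derive1 (primitive T f) t = f t}.
Proof.
move=> fT; have [g [mg fge ig fg]] := locally_integrable_from_borel fT.
pose h := g \_ `[T, +oo[.
have mT : @measurable _ B [set` `[T, +oo[] by exact: measurable_itv.
have mh : @measurable_fun _ _ B B setT h.
  by apply: (proj1 (@measurable_restrictT _ _ B B _ g mT)); exact: measurable_funTS.
have ih b : mu.-integrable `[T, b] (EFin \o h).
  apply: eq_integrable (ig b) => // x; rewrite inE/= in_itv/= => /andP[Tx _].
  by rewrite /h patchE mem_set// /= in_itv/= Tx.
have lh : locally_integrable setT h.
  split => //; first exact: openT.
  move=> K _ cK; have mK : measurable K by exact: compact_measurable.
  have [M [_ KM]] := compact_bounded cK.
  pose M1 : R := M + 1.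
  have Kb : K `<=` `]-oo, M1].
    move=> x Kx /=; rewrite in_itv/= (le_trans (ler_norm x))//.
    by apply: KM => //; rewrite /M1 ltrDl.
  apply: (@le_lt_trans _ _ (\int[mu]_(x in `[T, M1]) `|g x|%:E)%E); last first.
    by have /integrableP[] := ig M1.
  rewrite integral_mkcond [leRHS]integral_mkcond.
  apply: ge0_le_integral => //.
  - by move=> x _; apply: erestrict_ge0 => y _; rewrite lee_fin.
  - apply: (iffLR (measurable_restrictT _ _)); [by []|apply: measurable_funTS].
    by apply/measurable_EFinP; exact: measurableT_comp.
  - apply: (iffLR (measurable_restrictT _ _)); [by []|apply: measurable_funTS].
    by apply/measurable_EFinP; exact: measurableT_comp.
  - move=> x _; rewrite !patchE; case: ifPn => [|_]; last first.
      by case: ifPn => // _; rewrite lee_fin.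
    rewrite inE => Kx; rewrite /h patchE.
    case: ifPn => [|_]; last by rewrite normr0; case: ifPn => // _; rewrite lee_fin.
    rewrite inE/= in_itv/= andbT => Tx; rewrite mem_set//= in_itv/= Tx/=.
    by have := Kb _ Kx; rewrite /= in_itv.
have FE : primitive T f = fun x => \int[mu]_(t in `[T, x]) h t.
  apply/funext => x; rewrite /primitive /Rintegral fg//.
    congr fine; apply: eq_integral => z; rewrite inE/= in_itv/= => /andP[Tz _].
    by rewrite /h patchE mem_set//= in_itv/= Tz.
  by move=> z /=; rewrite !in_itv/= => /andP[->].
have := @FTC1 R h (BLeft T) ih lh; rewrite -FE => -[N [mN N0 sub]].
have nN : {ae leb R, forall x : R, ~ N x}.
  by apply/leb_negligibleP; exists N; split => // x /= /contrapT.
apply: ae_lebS (ae_lebI fge nN) => x [fgx nNx] Tx.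
have [dx ->] : derivable (primitive T f) x 1 /\ derive1 (primitive T f) x = h x.
  by apply: contrapT => H; apply: nNx; apply: sub => /= /(_ _)/H; exact; exact: ltW.
split => //; rewrite fgx ?ltW// /h patchE mem_set// /= in_itv/= andbT.
exact: ltW.
Qed.

End Primitive.

(** * Absolutely continuous functions with a nonnegative derivative *)

Section AbsolutelyContinuous.
Context {R : realType}.
Local Notation mu := (@lebesgue_measure R).
Implicit Types (f g : R -> R) (T a b s t x y : R).

(** Cousin's lemma as an induction principle: a transitive relation between
    end points that holds on all small intervals around each point holds on [a, b].
    The proof moves the right end point past the supremum of the points that can
    be reached from [a]. *)
Lemma cousin_ind (P : R -> R -> Prop) a b : a <= b ->
  (forall x y z, a <= x -> x <= y -> y <= z -> z <= b -> P x y -> P y z -> P x z) ->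
  (forall t, a <= t -> t <= b -> exists2 d, 0 < d & forall x y,
     a <= x -> x <= t -> t <= y -> y <= b -> t - d < x -> y < t + d -> P x y) ->
  P a b.
Proof.
move=> ab Ptrans Ploc.
pose S : set R := [set x | [/\ a <= x, x <= b & P a x]].
have Sa : S a.
  have [d d0 Pd] := Ploc a (lexx a) ab.
  by split => //; apply: Pd => //; [rewrite gtrBl|rewrite ltrDl].
have Sub : ubound S b by move=> x [].
have hsS : has_sup S by split; [exists a|exists b].
have ac : a <= sup S by apply: ub_le_sup => //; exists b.
have cb : sup S <= b by apply: ge_sup => //; exists a.
have [d d0 Pd] := Ploc _ ac cb.
have [x [ax xb Pax] cx] := sup_adherent d0 hsS.
have xc : x <= sup S by apply: ub_le_sup => //; exists b.
pose y := Num.min b (sup S + d / 2).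
have cy : sup S <= y by rewrite le_min cb lerDl divr_ge0// ltW.
have yb : y <= b by rewrite ge_min lexx.
have ay : P a y.
  apply: (Ptrans a x y) => //; first exact: le_trans cy.
  apply: Pd => //; rewrite /y gt_min; apply/orP; right.
  by rewrite ltrD2l ltr_pdivrMr// ltr_pMr// ltr1n.
have : y <= sup S.
  by apply: ub_le_sup; [exists b|split => //; rewrite (le_trans ac)].
rewrite /y ge_min; case/orP => [bc|]; last first.
  by rewrite gerDl leNgt divr_gt0.
by move: ay; rewrite /y min_l//; rewrite (le_trans bc)// lerDl divr_ge0// ltW.
Qed.

Lemma derive1_ge0_local f t e : 0 < e -> derivable f t 1 -> 0 <= derive1 f t ->
  exists2 d, 0 < d & forall x y, x <= t -> t <= y -> t - d < x -> y < t + d ->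
    f x - f y <= e * (y - x).
Proof.
move=> e0 df f'0.
have : h^-1 *: ((f \o shift t) (h *: 1) - f t) @[h --> 0^'] --> derive1 f t.
  by rewrite derive1E; exact: df.
move/cvgrPdist_lt => /(_ _ e0)[d /= d0 fd].
have key h : `|h| < d -> h != 0 -> - e < h^-1 * (f (h + t) - f t).
  move=> hd h0; have := fd h; rewrite /= sub0r normrN => /(_ hd h0).
  rewrite /= /GRing.scale/= mulr1 => /ltr_distlBl; rewrite ltrBlDr => H.
  lra.
exists d => // x y xt ty dx yd.
have fxt : f x - f t <= e * (t - x).
  have [->|nxt] := eqVneq x t; first by rewrite !subrr mulr0.
  have xt' : x - t < 0 by rewrite subr_lt0 lt_neqAle nxt.
  have := key (x - t); rewrite ltr0_norm// opprB subrK lt_eqF// => /(_ _ isT).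
  have -> : t - x < d by lra.
  by move=> /(_ isT); rewrite ltr_ndivlMl// => H; lra.
have fty : f t - f y <= e * (y - t).
  have [->|nyt] := eqVneq y t; first by rewrite !subrr mulr0.
  have yt' : 0 < y - t by rewrite subr_gt0 lt_neqAle eq_sym nyt.
  have := key (y - t); rewrite gtr0_norm// subrK gt_eqF// => /(_ _ isT).
  have -> : y - t < d by lra.
  by move=> /(_ isT); rewrite ltr_pdivlMl// => H; lra.
lra.
Qed.

Lemma negligible_open_cover (N : set R) e : 0 < e -> (leb R).-negligible N ->
  exists U : set R, [/\ open U, N `<=` U & (mu U < e%:E)%E].
Proof.
move=> e0 /leb_negligibleP[M [mM M0 NM]].
have Moo : (mu M < +oo)%E by rewrite M0.
have [U [oU MU Ue]] := lebesgue_regularity_outer mM Moo e0.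
exists U; split => //; first exact: subset_trans MU.
have mUM : measurable (U `\` M).
  by apply: measurableD => //; exact: open_measurable.
have -> : mu U = (mu M + mu (U `\` M))%E.
  by rewrite -[in LHS](setDUK MU) measureU// setDIK.
by rewrite M0 add0e.
Qed.

Lemma sum_itv_le_measure m (x y : 'I_m -> R) (U : set R) :
  (forall i, x i <= y i) -> trivIset setT (fun i => `]x i, y i[%classic) ->
  (forall i, `]x i, y i[ `<=` U) -> measurable U ->
  ((\sum_(i < m) (y i - x i))%:E <= mu U)%E.
Proof.
move=> xy tri xyU mU.
rewrite -measure_bigsetU_itv//; apply: le_measure; rewrite ?inE//.
  by apply: bigsetU_measurable => i _.
apply: (big_ind (fun A => A `<=` U)) => [|A C AU CU|i _] //.
by rewrite subUset.
Qed.

(** Cover the exceptional null set by an open set [U] of small measure and apply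
    Cousin's lemma.  A short interval around a good point contributes a decrease
    of at most [e] times its length; around an exceptional point it lies in [U].
    The intervals of the second kind are disjoint of small total length, so by
    absolute continuity they contribute at most [e] altogether. *)
Lemma absolutely_continuous_le f a b : a <= b -> absolutely_continuous a b f ->
  {ae leb R, forall t, a < t -> t < b -> derivable f t 1 /\ 0 <= derive1 f t} ->
  f a <= f b.
Proof.
move=> ab acf fae; apply/ler_addgt0Pl => e' e'0.
(* Good intervals cost [e * (b - a)] in all, exceptional ones [e]. *)
pose e := e' / (b - a + 1).
have ba1 : 0 < b - a + 1 by lra.
have e0 : 0 < e by rewrite divr_gt0.
have [d d0 hd] := acf e e0.
pose E : set R := [set a; b] `|`
  [set t | a < t /\ t < b /\ ~ (derivable f t 1 /\ 0 <= derive1 f t)].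
have [U [oU EU Ud]] : exists U : set R, [/\ open U, E `<=` U & (mu U < d%:E)%E].
  apply: negligible_open_cover => //; apply/leb_negligibleP; apply: negligibleU.
    apply: negligibleU; apply/negligibleP => //; exact: lebesgue_measure_set1.
  move/leb_negligibleP : fae; apply: (@negligibleS _ _ _ mu) => t /= [at_ [tb nt]] H.
  by apply: nt; exact: H.
(* [P x y]: a decrease of [f] on [x, y] beyond the rate [e] is paid for by
   disjoint intervals inside [U]. *)
pose P x y := exists m (X Y : 'I_m -> R), [/\
  forall i, [/\ x <= X i, X i <= Y i, Y i <= y & `]X i, Y i[ `<=` U],
  trivIset setT (fun i => `]X i, Y i[%classic) &
  f x - f y <= e * (y - x) + \sum_(i < m) `|f (Y i) - f (X i)|].
have [m [X [Y [XY tri fab]]]] : P a b.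
  apply: cousin_ind => //.
  - move=> x y z ax xy yz zb [m [X [Y [XY triX fxy]]]] [m' [X' [Y' [XY' triX' fyz]]]].
    pose c (u : 'I_m -> R) (u' : 'I_m' -> R) (i : 'I_(m + m')) :=
      match fintype.split i with inl j => u j | inr j => u' j end.
    exists (m + m')%N, (c X X'), (c Y Y'); split.
    + move=> i; rewrite /c; case: splitP => j _.
        by have [? ? ? ?] := XY j; split => //; exact: le_trans yz.
      by have [? ? ? ?] := XY' j; split => //; exact: le_trans xy _.
    + move=> i j _ _; rewrite /c.
      case: (splitP i) => i' ii'; case: (splitP j) => j' jj' /= [w []] /=;
        rewrite !in_itv/= => /andP[w1 w2] /andP[w3 w4].
      * apply: ord_inj; rewrite ii' jj'; congr (nat_of_ord _); apply: triX => //.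
        by exists w; split; rewrite /= in_itv/= ?w1 ?w3.
      * by exfalso; have [_ _ Yy _] := XY i'; have [yX _ _ _] := XY' j'; lra.
      * by exfalso; have [_ _ Yy _] := XY j'; have [yX _ _ _] := XY' i'; lra.
      * apply: ord_inj; rewrite ii' jj'; congr (_ + nat_of_ord _)%N; apply: triX' => //.
        by exists w; split; rewrite /= in_itv/= ?w1 ?w3.
    + rewrite big_split_ord/=.
      under eq_bigr do rewrite /c (unsplitK (inl _)).
      under [X in _ + (_ + X)]eq_bigr do rewrite /c (unsplitK (inr _)).
      lra.
  - move=> t at_ tb; have [Et|nEt] := pselect (E t).
      have [d' /= d'0 dU] := open_nbhs_nbhs (conj oU (EU _ Et)).
      exists d' => // x y ax xt ty yb dx yd.
      exists 1%N, (fun=> x), (fun=> y); split.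
      + move=> _; split => //; first exact: le_trans ty.
        move=> z /=; rewrite in_itv/= => /andP[xz zy]; apply: dU => /=.
        by rewrite distrC ltr_distlC; apply/andP; split; lra.
      + by move=> i j _ _ _; rewrite !ord1.
      + rewrite big_ord1 distrC (le_trans (ler_norm _))// lerDr mulr_ge0//; [exact: ltW|lra].
    have [df f'0] : derivable f t 1 /\ 0 <= derive1 f t.
      apply: contrapT => H; apply: (nEt); right; split; last split => //.
        by rewrite lt_neqAle at_ andbT; apply/eqP => ta; apply: nEt; left; left.
      by rewrite lt_neqAle tb andbT; apply/eqP => ta; apply: nEt; left; right.
    have [d' d'0 H] := derive1_ge0_local e0 df f'0.
    exists d' => // x y ax xt ty yb dx yd; exists 0%N, (fun=> 0), (fun=> 0).
    split; [by case|by case|].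
    by rewrite big_ord0 addr0; exact: H.
have XYs : \sum_(i < m) (Y i - X i) < d.
  rewrite -lte_fin (le_lt_trans _ Ud)// sum_itv_le_measure//.
  - by move=> i; have [] := XY i.
  - by move=> i; have [] := XY i.
  - exact: open_measurable.
have := hd m X Y _ tri XYs => /(_ _)/wrap[i|]; first by have [] := XY i.
move=> H.
have : f a - f b <= e * (b - a) + e by lra.
have -> : e * (b - a) + e = e' by rewrite -[X in _ + X]mulr1 -mulrDr /e divfK// gt_eqF.
lra.
Qed.

End AbsolutelyContinuous.

Section Comparison.
Context {R : realType}.
Implicit Types (f g : R -> R) (T a b s t x y : R).

(** Only differences of [f] and [g] at the same points are compared, which
    covers both [g = - f] and [g = ln \o f] for [f] bounded away from 0. *)
Lemma absolutely_continuous_lipschitz a b f g K : absolutely_continuous a b f ->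
  (forall x y, a <= x -> x <= y -> y <= b -> `|g y - g x| <= K * `|f y - f x|) ->
  absolutely_continuous a b g.
Proof.
move=> acf gf e e0; have K0 : 0 < `|K| + 1 by rewrite ltr_wpDl.
have [d d0 hd] := acf (e / (`|K| + 1)) (divr_gt0 e0 K0).
exists d => // m x y xyb tri xyd.
apply: (@le_lt_trans _ _ ((`|K| + 1) * \sum_(i < m) `|f (y i) - f (x i)|)).
  rewrite mulr_sumr; apply: ler_sum => i _; have [ax xy yb] := xyb i.
  rewrite (le_trans (gf _ _ ax xy yb))// ler_wpM2r// (le_trans (ler_norm K))//.
  by rewrite lerDl.
by rewrite -ltr_pdivlMl// mulrC; exact: hd xyd.
Qed.

Lemma absolutely_continuousD a b f g : absolutely_continuous a b f ->
  absolutely_continuous a b g -> absolutely_continuous a b (f \+ g).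
Proof.
move=> acf acg e e0; have e2 : 0 < e / 2 by rewrite divr_gt0.
have [d d0 hd] := acf _ e2; have [d' d'0 hd'] := acg _ e2.
exists (Num.min d d'); first by rewrite lt_min d0.
move=> m x y xyb tri; rewrite lt_min => /andP[xyd xyd'].
rewrite [ltRHS]splitr.
apply: le_lt_trans (ltrD (hd m x y xyb tri xyd) (hd' m x y xyb tri xyd')).
rewrite -big_split; apply: ler_sum => i _ /=.
by rewrite opprD addrACA ler_normD.
Qed.

Lemma absolutely_continuousN a b f : absolutely_continuous a b f ->
  absolutely_continuous a b (\- f).
Proof.
move=> acf; apply: (absolutely_continuous_lipschitz (K := 1) acf) => x y _ _ _.
by rewrite mul1r /= -opprD normrN.
Qed.

Lemma absolutely_continuousS a b a' b' f : a <= a' -> b' <= b ->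
  absolutely_continuous a b f -> absolutely_continuous a' b' f.
Proof.
move=> aa' bb' acf e e0; have [d d0 hd] := acf e e0.
exists d => // m x y xyb; apply: hd => i; have [ax xy yb] := xyb i.
by split => //; [exact: le_trans ax|exact: le_trans yb _].
Qed.

Lemma primitive_le_increment T f g s t :
  locally_absolutely_continuous_from T f -> locally_integrable_from T g ->
  {ae leb R, forall t, T < t -> derivable f t 1 /\ g t <= derive1 f t} ->
  T <= s -> s <= t -> primitive s g t <= f t - f s.
Proof.
move=> acf ig fg Ts st; rewrite -(primitiveB ig Ts st).
suff : (f \+ \- primitive T g) s <= (f \+ \- primitive T g) t by rewrite /=; lra.
apply: absolutely_continuous_le => //.
  apply: (absolutely_continuousS Ts (lexx t)).
  by apply: absolutely_continuousD => //; apply: absolutely_continuousN; exact: primitive_ac.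
apply: ae_lebS (ae_lebI fg (primitive_derivable ig)) => x [fgx gx] sx xt.
have Tx := le_lt_trans Ts sx.
have [df gf] := fgx Tx; have [dg gE] := gx Tx.
have dN : derivable (\- primitive T g) x 1 by exact: derivableN.
split; first exact: derivableD.
by rewrite derive1E (deriveD df dN) (deriveN dg) -!derive1E gE subr_ge0.
Qed.

Lemma derive1_ge0_homo T f : locally_absolutely_continuous_from T f ->
  {ae leb R, forall t, T < t -> derivable f t 1 /\ 0 <= derive1 f t} ->
  forall s t, T <= s -> s <= t -> f s <= f t.
Proof.
move=> acf fae s t Ts st; apply: absolutely_continuous_le => //.
  exact: (absolutely_continuousS Ts (lexx t)).
by apply: ae_lebS fae => x fx sx _; apply: fx; exact: le_lt_trans sx.
Qed.

End Comparison.

(** * Integrals of nonnegative functions on half-lines *)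

Section NonnegativeIntegrals.
Context {R : realType}.
Local Notation B := (measurableTypeR R).
Local Notation L := (lebesgueR R).

(** The integral with the carrier [R] in its type in place of the convertible
    [lebesgueR R], which keeps unification away from the measurable structure. *)
Definition lebint (D : set R) (F : R -> \bar R) : \bar R :=
  (\int[leb R]_(s in D) F s)%E.

Lemma lebint_ge0 D F : (forall x, D x -> 0 <= F x)%E -> (0 <= lebint D F)%E.
Proof. by move=> F0; exact: (@integral_ge0 _ L R (leb R)). Qed.

Lemma le_lebint (D : set R) (F G : R -> \bar R) : @measurable _ L D ->
  @measurable_fun _ _ L _ D F -> @measurable_fun _ _ L _ D G ->
  (forall x, D x -> 0 <= F x)%E -> (forall x, D x -> F x <= G x)%E ->
  (lebint D F <= lebint D G)%E.
Proof. by move=> mD mF mG F0 FG; exact: (@ge0_le_integral _ L R (leb R)). Qed.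

Lemma subset_lebint (D E : set R) (F : R -> \bar R) : @measurable _ L D ->
  @measurable _ L E -> @measurable_fun _ _ L _ E F ->
  (forall x, E x -> 0 <= F x)%E -> D `<=` E -> (lebint D F <= lebint E F)%E.
Proof. by move=> mD mE mF F0 DE; exact: (@ge0_subset_integral _ L R (leb R)). Qed.

Lemma eq_lebint (D : set R) (F G : R -> \bar R) : {in D, F =1 G} ->
  lebint D F = lebint D G.
Proof. by move=> FG; exact: (@eq_integral _ L R (leb R)). Qed.

Lemma nondecreasing_measurable_ereal (F : R -> \bar R) :
  {homo F : s t / s <= t >-> (s <= t)%E} -> @measurable_fun _ _ L _ setT F.
Proof.
move=> ndF; apply: measurable_funT_leb.
apply: (measurability (@ErealGenCInfty.G R)) => [|/= _ [_] [r] -> <-].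
  exact: ErealGenCInfty.measurableE.
rewrite setTI; apply: is_interval_measurable => s t/=.
rewrite !in_itv/= !andbT => Fs Ft u /andP[su ut].
by rewrite in_itv/= andbT (le_trans Fs)// ndF.
Qed.

Lemma nonincreasing_measurable_ereal (F : R -> \bar R) :
  {homo F : s t / s <= t >-> (t <= s)%E} -> @measurable_fun _ _ L _ setT F.
Proof.
move=> niF; apply: measurable_funT_leb.
apply: (measurability (@ErealGenCInfty.G R)) => [|/= _ [_] [r] -> <-].
  exact: ErealGenCInfty.measurableE.
rewrite setTI; apply: is_interval_measurable => s t/=.
rewrite !in_itv/= !andbT => Fs Ft u /andP[su ut].
by rewrite in_itv/= andbT (le_trans Ft)// niF.
Qed.

(** Monotone convergence along the intervals [[s, s + n]]. *)
Lemma lebint_itvy_le (F : R -> \bar R) (s : R) (c : \bar R) :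
  @measurable_fun _ _ L _ `[s, +oo[ F -> (forall x, s <= x -> (0 <= F x)%E) ->
  (forall b, s <= b -> (lebint `[s, b] F <= c)%E) -> (lebint `[s, +oo[ F <= c)%E.
Proof.
move=> mF F0 Fc.
pose D (n : nat) : set R := [set` `[s, s + n%:R]].
have DE : [set` `[s, +oo[] = \bigcup_n D n.
  apply/seteqP; split => [x /=|x [n _] /=]; rewrite !in_itv/= ?andbT.
    move=> sx; exists (Num.bound (x - s)) => //=; rewrite /D/= in_itv/= sx/=.
    by rewrite -lerBlDl; exact/ltW/unstable.ltr_bound.
  by case/andP.
have mD n : @measurable _ L (D n) by exact: leb_measurable_itv.
have Ds n : D n `<=` [set` `[s, +oo[].
  by move=> x; rewrite /D/= !in_itv/= => /andP[->].
have ndD : nondecreasing_seq D.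
  move=> m n mn; apply/subsetPset => x; rewrite /D/= !in_itv/= => /andP[-> /le_trans]/=.
  by apply; rewrite lerD2l ler_nat.
have mFD n : @measurable_fun _ _ L _ (D n) F.
  exact: (@measurable_funS _ _ L _ _ _ F (leb_measurable_itv _) (Ds n) mF).
have F0D n x : D n x -> (0 <= F x)%E by move=> /Ds; rewrite /= in_itv/= andbT; exact: F0.
have := @ge0_nondecreasing_set_cvg_integral _ L R D F (leb R) ndD mD mFD F0D.
rewrite -DE => cv; rewrite /lebint -(cvg_lim _ cv)//.
apply: lime_le; first by apply/cvg_ex; eexists; exact: cv.
by apply: nearW => n; apply: Fc; rewrite lerDl.
Qed.

End NonnegativeIntegrals.

(** * The least fixed point of a forward-backward integral operator *)

Section FixedPoint.
Context {R : realType}.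
Local Notation B := (measurableTypeR R).
Local Notation L := (lebesgueR R).
Context (T a : R) (f g : R -> R).
Context (a_ge0 : 0 <= a).
Context (f_ge0 : forall t, T <= t -> 0 <= f t).
Context (g_ge0 : forall t, T <= t -> 0 <= g t).
Context (mf : lebesgue_measurable_fun `[T, +oo[ f).
Context (mg : lebesgue_measurable_fun `[T, +oo[ g).
Implicit Types X Y : R -> \bar R.

(** The lower end point is cut off at [T] so that [backward X] is monotone on the
    whole line. *)
Definition backward X s : \bar R :=
  lebint `[Num.max T s, +oo[ (fun r => (g r)%:E * X r)%E.

Definition forward Y t : \bar R :=
  (a%:E + lebint `[T, t] (fun s => (f s)%:E * Y s))%E.

Definition nonneg_nondecreasing X :=
  (forall t, (0 <= X t)%E) /\ {homo X : s t / s <= t >-> (s <= t)%E}.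

Let measurable_weight (h : R -> R) (Y : R -> \bar R) (D : set R) :
  lebesgue_measurable_fun `[T, +oo[ h -> @measurable_fun _ _ L _ setT Y ->
  D `<=` `[T, +oo[ ->
  @measurable_fun _ _ L _ D (fun r => (h r)%:E * Y r)%E.
Proof.
move=> mh mY DT.
apply: (@measurable_funS _ _ L _ _ _ _ (leb_measurable_itv _) DT).
apply: (@emeasurable_funM _ L); last exact: measurable_funTS.
by apply/(@measurable_EFinP _ L); exact: mh.
Qed.

Let sub_maxT s : [set` `[Num.max T s, +oo[] `<=` [set` `[T, +oo[].
Proof. by move=> x /=; rewrite !in_itv/= !andbT ge_max => /andP[]. Qed.

Let sub_cc t : [set` `[T, t]] `<=` [set` `[T, +oo[].
Proof. by move=> x /=; rewrite !in_itv/= => /andP[->]. Qed.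

Lemma backward_ge0 X s : (forall t, (0 <= X t)%E) -> (0 <= backward X s)%E.
Proof.
move=> X0; apply: lebint_ge0 => x /sub_maxT; rewrite /= in_itv/= andbT => Tx.
by rewrite mule_ge0// lee_fin g_ge0.
Qed.

Lemma backward_nonincreasing X : nonneg_nondecreasing X ->
  {homo backward X : s t / s <= t >-> (t <= s)%E}.
Proof.
move=> [X0 ndX] s t st; apply: subset_lebint.
- exact: leb_measurable_itv.
- exact: leb_measurable_itv.
- exact: measurable_weight mg (nondecreasing_measurable_ereal ndX) (@sub_maxT _).
- move=> x /sub_maxT; rewrite /= in_itv/= andbT => Tx.
  by rewrite mule_ge0// lee_fin g_ge0.
- move=> x /=; rewrite !in_itv/= !andbT; apply: le_trans.
  by rewrite ge_max !le_max lexx st orbT.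
Qed.

Lemma backward_le X X' s : nonneg_nondecreasing X -> nonneg_nondecreasing X' ->
  (forall t, (X t <= X' t)%E) -> (backward X s <= backward X' s)%E.
Proof.
move=> [X0 ndX] [X'0 ndX'] XX'; apply: le_lebint.
- exact: leb_measurable_itv.
- exact: measurable_weight mg (nondecreasing_measurable_ereal ndX) (@sub_maxT _).
- exact: measurable_weight mg (nondecreasing_measurable_ereal ndX') (@sub_maxT _).
- move=> x /sub_maxT; rewrite /= in_itv/= andbT => Tx.
  by rewrite mule_ge0// lee_fin g_ge0.
- move=> x /sub_maxT; rewrite /= in_itv/= andbT => Tx.
  by rewrite lee_wpmul2l// lee_fin g_ge0.
Qed.

Let mbackward X : nonneg_nondecreasing X -> @measurable_fun _ _ L _ setT (backward X).
Proof. by move=> mX; exact/nonincreasing_measurable_ereal/backward_nonincreasing. Qed.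

Lemma forward_backward_monotone X : nonneg_nondecreasing X ->
  nonneg_nondecreasing (forward (backward X)).
Proof.
move=> mX; have [X0 ndX] := mX.
have ge0 t x : [set` `[T, t]] x -> (0 <= (f x)%:E * backward X x)%E.
  move=> /sub_cc; rewrite /= in_itv/= andbT => Tx.
  by rewrite mule_ge0// ?backward_ge0// lee_fin f_ge0.
split=> [t|s t st].
  by rewrite adde_ge0// lebint_ge0//; exact: ge0.
rewrite leeD2l//; apply: subset_lebint.
- exact: leb_measurable_itv.
- exact: leb_measurable_itv.
- exact: measurable_weight mf (mbackward mX) (@sub_cc _).
- exact: ge0.
- by move=> x /=; rewrite !in_itv/= => /andP[-> /le_trans]; exact.
Qed.

Lemma forward_le Y Y' t : @measurable_fun _ _ L _ setT Y ->
  @measurable_fun _ _ L _ setT Y' -> (forall s, (0 <= Y s)%E) ->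
  (forall s, (Y s <= Y' s)%E) -> (forward Y t <= forward Y' t)%E.
Proof.
move=> mY mY' Y0 YY'; rewrite leeD2l//; apply: le_lebint.
- exact: leb_measurable_itv.
- exact: measurable_weight mf mY (@sub_cc _).
- exact: measurable_weight mf mY' (@sub_cc _).
- move=> x /sub_cc; rewrite /= in_itv/= andbT => Tx.
  by rewrite mule_ge0// lee_fin f_ge0.
- move=> x /sub_cc; rewrite /= in_itv/= andbT => Tx.
  by rewrite lee_wpmul2l// lee_fin f_ge0.
Qed.

(** Knaster and Tarski in the lattice of nonnegative nondecreasing functions.
    A pointwise infimum of such functions is again one, so it is measurable, which
    a general infimum need not be. *)
Lemma least_fixed_point X0 : nonneg_nondecreasing X0 ->
  (forall t, (forward (backward X0) t <= X0 t)%E) ->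
  exists U, [/\ nonneg_nondecreasing U, forall t, (U t <= X0 t)%E &
    forall t, U t = forward (backward U) t].
Proof.
move=> mX0 sX0.
pose S := [set X | nonneg_nondecreasing X /\ (forall t, (forward (backward X) t <= X t)%E)].
pose U t := ereal_inf [set X t | X in S].
have UX X t : S X -> (U t <= X t)%E.
  by move=> SX; apply: ereal_inf_lbound; exists X.
have mU : nonneg_nondecreasing U.
  split=> [t|s t st].
    by apply: le_ereal_inf_tmp => _ [X [[X_ge0 _] _] <-].
  apply: le_ereal_inf_tmp => _ [X SX <-]; apply: (le_trans (UX _ _ SX)).
  by have [[_ ndX] _] := SX; exact: ndX.
have PhiU t : (forward (backward U) t <= U t)%E.
  apply: le_ereal_inf_tmp => _ [X SX <-]; have [mX sX] := SX.
  apply: le_trans (sX t); apply: forward_le; [exact: mbackward..| |].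
    by move=> s; apply: backward_ge0; case: mU.
  by move=> s; apply: backward_le => // r; exact: UX.
have mPhiU := forward_backward_monotone mU.
exists U; split => //; first by move=> t; exact: UX.
move=> t; apply/eqP; rewrite eq_le PhiU andbT; apply: UX.
split; [exact: mPhiU|move=> s].
apply: forward_le; [exact: mbackward..| |].
  by move=> r; apply: backward_ge0; case: mPhiU.
by move=> r; apply: backward_le.
Qed.

End FixedPoint.

Section IntegralSystem.
Context {R : realType}.
Local Notation B := (measurableTypeR R).
Local Notation L := (lebesgueR R).
Implicit Types (f g h : R -> R) (T a : R).

Lemma eq_primitive T f g : (forall t, T <= t -> f t = g t) ->
  primitive T f = primitive T g.
Proof.
move=> fg; apply/funext => t; congr fine; apply: eq_lebint => s.
by rewrite inE/= in_itv/= => /andP[Ts _]; rewrite fg.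
Qed.

Lemma eq_locally_integrable_from T f g : (forall t, T <= t -> f t = g t) ->
  locally_integrable_from T f -> locally_integrable_from T g.
Proof.
move=> fg fT b; apply: (@eq_integrable _ L R (leb R) _ _ (EFin \o f)) (fT b).
  exact: leb_measurable_itv.
by move=> s; rewrite inE/= in_itv/= => /andP[Ts _]; rewrite /= fg.
Qed.

Lemma locally_integrable_fromM T f h : locally_integrable_from T f ->
  lebesgue_measurable_fun `[T, +oo[ h ->
  (forall b, [bounded h t | t in `[T, b]]) ->
  locally_integrable_from T (fun t => f t * h t).
Proof.
move=> fT mh hb b.
have mhb : @measurable_fun _ _ L B [set` `[T, b]] h.
  apply: (@measurable_funS _ _ L B _ _ h (leb_measurable_itv _) _ mh).
  by move=> x; rewrite /= !in_itv/= => /andP[->].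
exact: (@integrableMl _ L R (leb R) _ (leb_measurable_itv _) (EFin \o f) h (fT b) mhb (hb b)).
Qed.

Lemma monotone_lebesgue_measurable T h :
  (forall s t, T <= s -> s <= t -> h s <= h t) ->
  lebesgue_measurable_fun `[T, +oo[ h.
Proof.
move=> ndh; rewrite /lebesgue_measurable_fun.
apply: (@eq_measurable_fun _ _ L B _ (fun t => h (Num.max T t))).
  by move=> t; rewrite inE/= in_itv/= andbT => Tt; rewrite max_r.
apply: (@measurable_funTS _ _ L B); apply: measurable_funT_leb.
apply: nondecreasing_measurable => // s t st; apply: ndh.
  by rewrite le_max lexx.
by rewrite ge_max !le_max lexx st orbT.
Qed.

Lemma locally_integrable_fromM_nondecreasing T f h : locally_integrable_from T f ->
  (forall s t, T <= s -> s <= t -> h s <= h t) ->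
  locally_integrable_from T (fun t => f t * h t).
Proof.
move=> fT ndh; apply: locally_integrable_fromM => //.
  exact: monotone_lebesgue_measurable.
move=> b; exists (`|h T| + `|h b|); split; first exact: num_real.
move=> M HM t /=; rewrite in_itv/= => /andP[Tt tb].
have hTt := ndh _ _ (lexx T) Tt; have htb := ndh _ _ Tt tb.
rewrite ler_norml; have := ler_norm (h b); have := ler_norm (- h T).
by rewrite normrN; have := normr_ge0 (h T); have := normr_ge0 (h b) => *; apply/andP; split; lra.
Qed.

Lemma locally_integrable_fromM_nonincreasing T f h : locally_integrable_from T f ->
  (forall s t, T <= s -> s <= t -> h t <= h s) ->
  locally_integrable_from T (fun t => f t * h t).
Proof.
move=> fT nih.
have := @locally_integrable_fromM_nondecreasing T (\- f) (\- h).
have NfT : locally_integrable_from T (\- f).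
  by move=> b; exact: (@integrableN _ L R (leb R) _ (EFin \o f) (fT b)).
move=> /(_ NfT) H; apply: (@eq_locally_integrable_from _ (fun t => (\- f) t * (\- h) t)).
  by move=> t _; rewrite /= mulrNN.
by apply: H => s t Ts st; rewrite /= lerN2 nih.
Qed.

Lemma lebint_primitive T h t : locally_integrable_from T h ->
  lebint `[T, t] (EFin \o h) = (primitive T h t)%:E.
Proof.
move=> hT; rewrite /primitive /Rintegral fineK//.
exact: (@integrable_fin_num _ L R (leb R) _ (leb_measurable_itv _) (EFin \o h) (hT t)).
Qed.

(** The two integrals on the right share the point [t], which is a null set. *)
Lemma lebint_itvy_split (F : R -> \bar R) (s t : R) : s <= t ->
  @measurable_fun _ _ L _ `[s, +oo[ F -> (forall x, s <= x -> (0 <= F x)%E) ->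
  lebint `[s, +oo[ F = (lebint `[s, t] F + lebint `[t, +oo[ F)%E.
Proof.
move=> st mF F0.
have mI (i : interval R) : @measurable _ L [set` i] by exact: leb_measurable_itv.
have mF' (i : interval R) : [set` i] `<=` [set` `[s, +oo[] ->
    @measurable_fun _ _ L _ [set` i] F.
  by move=> /(@measurable_funS _ _ L _ _ _ F (mI _)); exact.
have F0' (i : interval R) : [set` i] `<=` [set` `[s, +oo[] ->
    forall x, [set` i] x -> (0 <= F x)%E.
  by move=> + x ix => /(_ _ ix); rewrite /= in_itv/= andbT; exact: F0.
have subt : [set` `[t, +oo[] `<=` [set` `[s, +oo[].
  by move=> x; rewrite /= !in_itv/= !andbT; exact: le_trans.
have E1 : lebint `[s, +oo[ F = (lebint `[s, t] F + lebint `]t, +oo[ F)%E.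
  rewrite {1}/lebint (_ : [set` `[s, +oo[] = [set` `[s, t]] `|` [set` `]t, +oo[]); last first.
    by rewrite -itv_bndbnd_setU.
  apply: (@ge0_integral_setU _ L R (leb R)) => //.
  - by rewrite -itv_bndbnd_setU//; exact: mF'.
  - by rewrite -itv_bndbnd_setU//; exact: F0'.
  - apply/disj_setPS => x [/=]; rewrite !in_itv/= andbT => /andP[_ xs].
    by rewrite ltNge xs.
have E2 : lebint `[t, +oo[ F = (lebint [set t] F + lebint `]t, +oo[ F)%E.
  have tU : [set` `[t, +oo[] = [set t] `|` [set` `]t, +oo[].
    apply/seteqP; split => x /=; rewrite !in_itv/= !andbT.
      by rewrite le_eqVlt => /predU1P[->|]; [left|right].
    by move=> [->|/ltW].
  rewrite {1}/lebint tU.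
  apply: (@ge0_integral_setU _ L R (leb R)).
  - by apply: leb_measurable_borel; exact: measurable_set1.
  - exact: mI.
  - by rewrite -tU; exact: mF'.
  - by rewrite -tU; exact: F0'.
  - by apply/disj_setPS => x [/= ->]; rewrite in_itv/= ltxx.
rewrite E1 E2 [lebint [set t] F](_ : _ = 0%E) ?add0e//.
have mt : @measurable _ L [set t] by apply: leb_measurable_borel; exact: measurable_set1.
apply: (@null_set_integral _ L R (leb R)) => //.
  by apply: (@measurable_funS _ _ L _ _ _ F (mI `[s, +oo[) _ mF) => x ->; rewrite /= in_itv/= st.
exact: lebesgue_measure_set1.
Qed.

End IntegralSystem.

Section ExistsIntegralSystem.
Context {R : realType}.
Local Notation B := (measurableTypeR R).
Local Notation L := (lebesgueR R).

(** [x] is a supersolution of the monotone operator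
    [X |-> a + \int_T^t f (\int_s^oo g X)]; its least fixed point below [x] gives
    [u], and [v] is the inner integral.  Written as [v T] minus the integral of
    [g u] from [T] on, [v] can be differentiated.  Both formulas hold on the whole
    line because derivability is a two-sided notion. *)
Lemma exists_integral_system (T a : R) (f g x y : R -> R) : 0 <= a ->
  (forall t, T <= t -> 0 <= f t) -> (forall t, T <= t -> 0 <= g t) ->
  locally_integrable_from T f -> locally_integrable_from T g ->
  (forall s t, T <= s -> s <= t -> x s <= x t) -> 0 <= x T ->
  (forall s t, T <= s -> s <= t -> y t <= y s) ->
  (forall t, T <= t -> a + primitive T (fun s => f s * y s) t <= x t) ->
  (forall s t, T <= s -> s <= t -> primitive s (fun r => g r * x r) t <= y s) ->
  exists u v : R -> R, [/\
    locally_integrable_from T (fun s => f s * v s) /\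
    locally_integrable_from T (fun s => g s * u s),
    forall t, u t = a + primitive T (fun s => f s * v s) t,
    forall t, v t = v T - primitive T (fun s => g s * u s) t,
    forall t, T <= t -> 0 <= v t & forall t, T <= t -> a <= u t].
Proof.
move=> a0 f0 g0 fT gT ndx xT0 niy sx sy.
have mf := locally_integrable_from_measurable fT.
have mg := locally_integrable_from_measurable gT.
pose m s := Num.max T s.
have Tm s : T <= m s by rewrite /m le_max lexx.
have m_homo s t : s <= t -> m s <= m t.
  by move=> st; rewrite /m ge_max !le_max lexx st orbT.
have mE s : T <= s -> m s = s by move=> Ts; rewrite /m max_r.
have x0 t : T <= t -> 0 <= x t by move=> Tt; rewrite (le_trans xT0) ?ndx.
have igx := locally_integrable_fromM_nondecreasing gT ndx.
have ify := locally_integrable_fromM_nonincreasing fT niy.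
have y0 s : T <= s -> 0 <= y s.
  move=> Ts; apply: le_trans (sy s s Ts (lexx s)).
  apply: Rintegral_ge0 => r /=; rewrite in_itv/= => /andP[sr _].
  have Tr := le_trans Ts sr; apply: mulr_ge0; [exact: g0|exact: x0].
pose X0 t : \bar R := (x (m t))%:E.
have mX0 : nonneg_nondecreasing X0.
  split=> [t|s t st]; first by rewrite lee_fin x0.
  by rewrite lee_fin ndx// m_homo.
have bX0 s : (backward T g X0 s <= (y (m s))%:E)%E.
  apply: lebint_itvy_le.
  - have mX0' := nondecreasing_measurable_ereal mX0.2.
    have sub : [set` `[m s, +oo[] `<=` [set` `[T, +oo[].
      by move=> r; rewrite /= !in_itv/= !andbT; exact: le_trans.
    apply: (@measurable_funS _ _ L _ _ _ _ (leb_measurable_itv _) sub).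
    apply: (@emeasurable_funM _ L); last exact: measurable_funTS.
    by apply/(@measurable_EFinP _ L); exact: mg.
  - move=> r mr; have Tr := le_trans (Tm s) mr.
    by rewrite mule_ge0// lee_fin; [exact: g0|exact: x0].
  - move=> b mb.
    rewrite (@eq_lebint _ _ _ (EFin \o (fun r => g r * x r))); last first.
      move=> r; rewrite inE/= in_itv/= => /andP[mr _].
      by rewrite /X0 -EFinM mE// (le_trans (Tm s)).
    rewrite lebint_primitive; last exact: locally_integrable_fromS igx.
    by rewrite lee_fin; apply: sy.
have sX0 t : T <= t -> (forward T a f (backward T g X0) t <= X0 t)%E.
  move=> Tt; have mY : @measurable_fun _ _ L _ setT (fun s => (y (m s))%:E).
    apply: nonincreasing_measurable_ereal => s r sr; rewrite lee_fin.
    by apply: niy => //; exact: m_homo.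
  apply: (@le_trans _ _ (forward T a f (fun s => (y (m s))%:E) t)).
    have mbX : @measurable_fun _ _ L _ setT (backward T g X0).
      exact: nonincreasing_measurable_ereal (backward_nonincreasing g0 mg mX0).
    have bX_ge0 s : (0 <= backward T g X0 s)%E by apply: (backward_ge0 g0); case: mX0.
    exact: (forward_le _ f0 mf _ mbX mY bX_ge0 bX0).
  rewrite /forward (@eq_lebint _ _ _ (EFin \o (fun s => f s * y s))); last first.
    by move=> s; rewrite inE/= in_itv/= => /andP[Ts _]; rewrite mE.
  by rewrite (lebint_primitive _ ify) -EFinD lee_fin /X0 mE// sx.
(* For [t < T] the forward integral is empty, and monotonicity gives the bound. *)
have sX0' t : (forward T a f (backward T g X0) t <= X0 t)%E.
  have [Tt|tT] := leP T t; first exact: sX0.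
  have [_ nd] := forward_backward_monotone a0 f0 g0 mf mg mX0.
  apply: le_trans (nd _ _ (ltW tT)) _; apply: le_trans (sX0 _ (lexx T)) _.
  by rewrite /X0 /m maxxx max_l ?lexx// ltW.
have [U [mU UX UE]] := least_fixed_point a0 f0 g0 mf mg mX0 sX0'.
pose V := backward T g U.
have V0 s : (0 <= V s)%E by apply: (backward_ge0 g0); case: mU.
have U0 s : (0 <= U s)%E by case: mU.
have niV := backward_nonincreasing g0 mg mU.
have VX s : (V s <= (y (m s))%:E)%E.
  by apply: le_trans (bX0 s); exact: (backward_le g0 mg _ mU mX0 UX).
have Ufin t : U t \is a fin_num.
  by rewrite ge0_fin_numE// (le_lt_trans (UX t))// ltry.
have Vfin t : V t \is a fin_num.
  by rewrite ge0_fin_numE// (le_lt_trans (VX t))// ltry.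
pose u0 t := fine (U t); pose v0 t := fine (V t).
have u0E t : (u0 t)%:E = U t by rewrite fineK.
have v0E t : (v0 t)%:E = V t by rewrite fineK.
have v0_ge0 t : 0 <= v0 t by rewrite -lee_fin v0E.
have ndu0 s t : T <= s -> s <= t -> u0 s <= u0 t.
  by move=> _ st; rewrite -lee_fin !u0E; case: mU => _; exact.
have niv0 s t : T <= s -> s <= t -> v0 t <= v0 s.
  by move=> _ st; rewrite -lee_fin !v0E; exact: niV.
have igu := locally_integrable_fromM_nondecreasing gT ndu0.
have ifv := locally_integrable_fromM_nonincreasing fT niv0.
have u0P t : u0 t = a + primitive T (fun s => f s * v0 s) t.
  apply: EFin_inj; rewrite EFinD (u0E t) UE /forward.
  rewrite -(lebint_primitive t ifv).
  by congr (_ + _)%E; apply: eq_lebint => s _; rewrite /= EFinM v0E.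
have v0P t : T <= t -> v0 t = v0 T - primitive T (fun s => g s * u0 s) t.
  move=> Tt; suff : v0 T = primitive T (fun s => g s * u0 s) t + v0 t by lra.
  apply: EFin_inj; rewrite EFinD (v0E T) (v0E t) /V /backward maxxx (max_r Tt).
  rewrite -(lebint_primitive t igu).
  rewrite (lebint_itvy_split Tt).
  - by congr (_ + _)%E; apply: eq_lebint => s _; rewrite /= EFinM u0E.
  - apply: (@emeasurable_funM _ L).
      by apply/(@measurable_EFinP _ L); exact: mg.
    by apply: measurable_funTS; apply: nondecreasing_measurable_ereal; case: mU.
  - by move=> s Ts; rewrite mule_ge0// lee_fin g0.
pose v t := v0 T - primitive T (fun s => g s * u0 s) t.
have vE t : T <= t -> v0 t = v t := @v0P t.
have fvE t : T <= t -> f t * v0 t = f t * v t by move=> Tt; rewrite vE.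
exists u0, v; split.
- by split => //; apply: eq_locally_integrable_from ifv.
- by move=> t; rewrite -(eq_primitive fvE).
- by move=> t; rewrite -(vE T).
- by move=> t Tt; rewrite -vE.
- move=> t Tt; rewrite u0P lerDl; apply: Rintegral_ge0 => s /=.
  by rewrite in_itv/= => /andP[Ts _]; rewrite mulr_ge0// f0.
Qed.

End ExistsIntegralSystem.

(** * Positive solutions from positive supersolutions *)

Section PositiveSolutions.
Context {R : realType}.
Local Notation B := (measurableTypeR R).
Local Notation L := (lebesgueR R).
Implicit Types (p Q h u v w x y : R -> R) (T a c e s t : R).

Definition positive_solution T p Q := exists u, [/\
  locally_absolutely_continuous_from T u,
  satisfies_from T p u (fun t => Q t * u t) & forall t, T <= t -> 0 < u t].

Lemma affine_primitive T h w c e : locally_integrable_from T h ->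
  (forall t, w t = c + e * primitive T h t) ->
  locally_absolutely_continuous_from T w /\
  {ae leb R, forall t, T <= t -> derivable w t 1 /\ derive1 w t = e * h t}.
Proof.
move=> hT wE; split=> [b|].
  have acT : absolutely_continuous T b (primitive T h) by exact: primitive_ac.
  apply: (absolutely_continuous_lipschitz (K := `|e|) acT).
  by move=> s t _ _ _; rewrite !wE opprD addrACA subrr add0r -mulrBr normrM.
have wF : w = (fun=> c) \+ e *: primitive T h by apply/funext => t; rewrite wE.
have nT : {ae leb R, forall t, t <> T}.
  apply/leb_negligibleP; exists [set T]; split.
  - exact: measurable_set1.
  - exact: lebesgue_measure_set1.
  - by move=> t /= /contrapT.
apply: ae_lebS (ae_lebI nT (primitive_derivable hT)) => t [tT ht] Tt.
have Tlt : T < t by rewrite lt_neqAle Tt andbT eq_sym; apply/eqP.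
have [dh hE] := ht Tlt.
have de : derivable (e *: primitive T h) t 1 by exact: derivableZ.
rewrite wF; split; first exact: (derivableD (derivable_cst _ _ _) de).
rewrite derive1E (deriveD (derivable_cst _ _ _) de) (deriveZ e dh) derive_cst add0r.
by rewrite -derive1E hE.
Qed.

Lemma primitive_gt0 T h s t : locally_integrable_from T h -> T <= s -> s < t ->
  (forall r, T <= r -> 0 < h r) -> 0 < primitive s h t.
Proof.
move=> hT Ts st h0; have hs := locally_integrable_fromS Ts hT.
have ge0 : 0 <= primitive s h t.
  apply: Rintegral_ge0 => r; rewrite /= in_itv/= => /andP[sr _].
  by apply/ltW/h0/(le_trans Ts).
rewrite lt_neqAle ge0 andbT eq_sym; apply/eqP => pE.
have mD : @measurable _ L [set` `[s, t]] := leb_measurable_itv _.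
have mh : @measurable_fun _ _ L _ [set` `[s, t]] (EFin \o h).
  by have /measurable_int := hs t.
have /(ae_eq_integral_abs (leb R) mD mh)[N [mN N0 sub]] :
    (\int[leb R]_(x in `[s, t]) `|(EFin \o h) x| = 0)%E.
  rewrite -[RHS]/(0%:E) -pE -(lebint_primitive t hs); apply: eq_lebint => r.
  rewrite inE/= in_itv/= => /andP[sr _].
  by rewrite ger0_norm// ltW// h0// (le_trans Ts).
have : leb R [set` `[s, t]] = (t - s)%:E.
  transitivity (@lebesgue_measure R `[s, t]%classic) => //.
  by rewrite lebesgue_measure_itv/= lte_fin st -EFinB.
have -> : leb R [set` `[s, t]] = 0%E.
  apply: (@subset_measure0 _ L R (leb R) _ _ mD mN _ N0) => r rst; apply: sub => /=.
  move=> /(_ rst) [] rE; move: rst; rewrite /= in_itv/= => /andP[sr _].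
  by have := h0 r (le_trans Ts sr); rewrite rE ltxx.
by move=> [] /eqP; rewrite eq_sym subr_eq0 gt_eqF.
Qed.

(** The solution is [u] with flux [v]; it stays above its initial value [x T]. *)
Lemma positive_solution_nondecreasing T p Q x y :
  (forall t, T <= t -> 0 < p t) -> locally_integrable_from T (fun t => 1 / p t) ->
  (forall t, T <= t -> 0 <= Q t) -> locally_integrable_from T Q ->
  (forall s t, T <= s -> s <= t -> x s <= x t) -> 0 < x T ->
  (forall s t, T <= s -> s <= t -> y t <= y s) ->
  (forall t, T <= t -> primitive T (fun s => 1 / p s * y s) t <= x t - x T) ->
  (forall s t, T <= s -> s <= t -> primitive s (fun r => Q r * x r) t <= y s) ->
  positive_solution T p Q.
Proof.
move=> p0 ip Q0 iQ ndx xT niy hx hy.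
have ip0 t : T <= t -> 0 <= 1 / p t.
  by move=> Tt; rewrite div1r invr_ge0 ltW// p0.
have [|u [v [[ifv igu] uE vE v0 u0]]] := exists_integral_system (ltW xT) ip0 Q0
    ip iQ ndx (ltW xT) niy _ hy.
  by move=> t Tt; have := hx t Tt; lra.
have [acu du] : locally_absolutely_continuous_from T u /\
    {ae leb R, forall t, T <= t -> derivable u t 1 /\ derive1 u t = 1 * (1 / p t * v t)}.
  by apply: (affine_primitive (c := x T) ifv) => t; rewrite mul1r.
have [acv dv] : locally_absolutely_continuous_from T v /\
    {ae leb R, forall t, T <= t -> derivable v t 1 /\ derive1 v t = (-1) * (Q t * u t)}.
  by apply: (affine_primitive (c := v T) igu) => t; rewrite mulN1r.
exists u; split => //; last by move=> t Tt; exact: lt_le_trans xT (u0 t Tt).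
exists v; split => //.
- apply: ae_lebS du => t dt Tt; have [dut ->] := dt Tt; split => //.
  by rewrite mul1r mulrA div1r mulfV ?mul1r// gt_eqF// p0.
- apply: ae_lebS dv => t dt Tt; have [dvt ->] := dt Tt; split => //.
  by rewrite mulN1r addNr.
Qed.

(** Here the roles are exchanged: the solution is [v], with flux [- u].  It is
    positive because [v t] exceeds [v (t + 1)] by the integral of the positive
    function [u / p]. *)
Lemma positive_solution_nonincreasing T p Q x y :
  (forall t, T <= t -> 0 < p t) -> locally_integrable_from T (fun t => 1 / p t) ->
  (forall t, T <= t -> 0 <= Q t) -> locally_integrable_from T Q ->
  (forall s t, T <= s -> s <= t -> x s <= x t) -> 0 < x T ->
  (forall s t, T <= s -> s <= t -> y t <= y s) ->
  (forall t, T <= t -> primitive T (fun s => Q s * y s) t <= x t - x T) ->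
  (forall s t, T <= s -> s <= t -> primitive s (fun r => 1 / p r * x r) t <= y s) ->
  positive_solution T p Q.
Proof.
move=> p0 ip Q0 iQ ndx xT niy hx hy.
have ip_gt0 t : T <= t -> 0 < 1 / p t.
  by move=> Tt; rewrite div1r invr_gt0 p0.
have ip0 t (Tt : T <= t) := ltW (ip_gt0 t Tt).
have [|u [v [[ifv igu] uE vE v0 u0]]] := exists_integral_system (ltW xT) Q0 ip0
    iQ ip ndx (ltW xT) niy _ hy.
  by move=> t Tt; have := hx t Tt; lra.
have [acu du] : locally_absolutely_continuous_from T (\- u) /\
    {ae leb R, forall t, T <= t -> derivable (\- u) t 1 /\ derive1 (\- u) t = (-1) * (Q t * v t)}.
  by apply: (affine_primitive (c := - x T) ifv) => t; rewrite /= uE opprD mulN1r.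
have [acv dv] : locally_absolutely_continuous_from T v /\
    {ae leb R, forall t, T <= t -> derivable v t 1 /\ derive1 v t = (-1) * (1 / p t * u t)}.
  by apply: (affine_primitive (c := v T) igu) => t; rewrite mulN1r.
exists v; split => //; last first.
  move=> t Tt; have Tt1 : T <= t + 1 by rewrite (le_trans Tt)// lerDl.
  apply: lt_le_trans (_ : 0 < v t - v (t + 1)) _; last first.
    by rewrite gerBl v0.
  have -> : v t - v (t + 1) = primitive t (fun r => 1 / p r * u r) (t + 1).
    by rewrite -(primitiveB igu Tt) ?lerDl// (vE t) (vE (t + 1)); lra.
  apply: (primitive_gt0 igu) => //; first by rewrite ltrDl.
  by move=> r Tr; rewrite mulr_gt0 ?ip_gt0// (lt_le_trans xT)// u0.
exists (\- u); split => //.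
- apply: ae_lebS dv => t dt Tt; have [dut ->] := dt Tt; split => //=.
  by rewrite mulN1r mulrN mulrA div1r mulfV ?mul1r// gt_eqF// p0.
- apply: ae_lebS du => t dt Tt; have [dvt ->] := dt Tt; split => //.
  by rewrite mulN1r addNr.
Qed.

End PositiveSolutions.

Section Supersolutions.
Context {R : realType}.
Implicit Types (p Q h x y : R -> R) (T s t c : R).

Lemma locally_absolutely_continuous_fromS T T' x : T <= T' ->
  locally_absolutely_continuous_from T x -> locally_absolutely_continuous_from T' x.
Proof. by move=> TT' acx b; exact: (absolutely_continuousS TT' (lexx b)). Qed.

Lemma flux_ge0_nondecreasing T p x y : (forall t, T <= t -> 0 < p t) ->
  locally_absolutely_continuous_from T x ->
  {ae leb R, forall t, T <= t -> derivable x t 1 /\ p t * derive1 x t = y t} ->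
  (forall t, T <= t -> 0 <= y t) ->
  forall s t, T <= s -> s <= t -> x s <= x t.
Proof.
move=> p0 acx dx y0; apply: derive1_ge0_homo => //.
apply: ae_lebS dx => t dt Tt; have [dxt E] := dt (ltW Tt); split => //.
by rewrite -(pmulr_rge0 _ (p0 _ (ltW Tt))) E y0// ltW.
Qed.

Lemma flux_equationN T p x y :
  {ae leb R, forall t, T <= t -> derivable x t 1 /\ p t * derive1 x t = y t} ->
  {ae leb R, forall t, T <= t ->
     derivable (\- x) t 1 /\ p t * derive1 (\- x) t = (\- y) t}.
Proof.
apply: ae_lebS => t dt Tt; have [dxt E] := dt Tt; split; first exact: derivableN.
by rewrite derive1E (deriveN dxt) -derive1E mulrN E.
Qed.

Lemma flux_increment T p x y : (forall t, T <= t -> 0 < p t) ->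
  locally_absolutely_continuous_from T x ->
  {ae leb R, forall t, T <= t -> derivable x t 1 /\ p t * derive1 x t = y t} ->
  locally_integrable_from T (fun t => 1 / p t * y t) ->
  forall s t, T <= s -> s <= t -> primitive s (fun r => 1 / p r * y r) t <= x t - x s.
Proof.
move=> p0 acx dx ipy s t; apply: primitive_le_increment => //.
apply: ae_lebS dx => r dr Tr; have [dxr E] := dr (ltW Tr); split => //.
by rewrite -E div1r mulKf// gt_eqF// p0// ltW.
Qed.

(** The inequality [y' <= - h], integrated. *)
Lemma supersolution_decrement T h F y : locally_absolutely_continuous_from T y ->
  {ae leb R, forall t, T <= t -> derivable y t 1 /\ derive1 y t + F t = 0} ->
  (forall t, T <= t -> h t <= F t) -> locally_integrable_from T h ->
  forall s t, T <= s -> s <= t -> primitive s h t <= y s - y t.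
Proof.
move=> acy dy hF ih s t Ts st.
have acNy : locally_absolutely_continuous_from T (\- y).
  by move=> b; apply: absolutely_continuousN; exact: acy.
suff : primitive s h t <= (\- y) t - (\- y) s by rewrite /=; lra.
apply: (primitive_le_increment acNy) => //.
apply: ae_lebS dy => r dr Tr; have [dyr E] := dr (ltW Tr).
split; first exact: derivableN.
rewrite derive1E (deriveN dyr) -derive1E.
by have := hF r (ltW Tr); lra.
Qed.

Lemma locally_integrable_from0 T : locally_integrable_from T (fun=> 0 : R).
Proof. by move=> b; exact: (@integrable0 _ (lebesgueR R) R (leb R)). Qed.

Lemma flux_nonincreasing T F y : locally_absolutely_continuous_from T y ->
  {ae leb R, forall t, T <= t -> derivable y t 1 /\ derive1 y t + F t = 0} ->
  (forall t, T <= t -> 0 <= F t) -> forall s t, T <= s -> s <= t -> y t <= y s.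
Proof.
move=> acy dy F0 s t Ts st; rewrite -subr_ge0.
apply: le_trans (supersolution_decrement acy dy F0 (@locally_integrable_from0 T) Ts st).
exact: Rintegral_ge0.
Qed.

(** The flux [y] of a positive supersolution is nonincreasing.  When it is
    nonnegative, [y s] bounds the integral of [Q x] over [[s, +oo[]; when it is
    negative, [x s] bounds that of [- y / p], because [x] stays positive.  These
    are the bounds on improper integrals required by the fixed point argument. *)
Lemma positive_supersolution T p Q F x y :
  (forall t, T <= t -> 0 < p t) -> locally_integrable_from T (fun t => 1 / p t) ->
  (forall t, T <= t -> 0 <= Q t) -> locally_integrable_from T Q ->
  locally_absolutely_continuous_from T x -> locally_absolutely_continuous_from T y ->
  {ae leb R, forall t, T <= t -> derivable x t 1 /\ p t * derive1 x t = y t} ->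
  {ae leb R, forall t, T <= t -> derivable y t 1 /\ derive1 y t + F t = 0} ->
  (forall t, T <= t -> 0 < x t) -> (forall t, T <= t -> Q t * x t <= F t) ->
  (y T < 0 \/ forall t, T <= t -> 0 <= y t) ->
  positive_solution T p Q.
Proof.
move=> p0 ip Q0 iQ acx acy dx dy x0 QF y_sign.
have F0 t : T <= t -> 0 <= F t.
  by move=> Tt; rewrite (le_trans _ (QF t Tt))// mulr_ge0 ?Q0// ltW ?x0.
have niy := flux_nonincreasing acy dy F0.
case: y_sign => [yT|y0]; last first.
  have ndx := flux_ge0_nondecreasing p0 acx dx y0.
  have iQx := locally_integrable_fromM_nondecreasing iQ ndx.
  have ipy := locally_integrable_fromM_nonincreasing ip niy.
  apply: (positive_solution_nondecreasing p0 ip Q0 iQ ndx (x0 _ (lexx T)) niy).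
    by move=> t Tt; exact: (flux_increment p0 acx dx ipy (lexx T) Tt).
  move=> s t Ts st; rewrite (le_trans (supersolution_decrement acy dy QF iQx Ts st))//.
  by rewrite gerBl; apply: y0; exact: le_trans st.
have y_lt0 t : T <= t -> y t < 0 by move=> Tt; rewrite (le_lt_trans _ yT)// niy.
have acNx : locally_absolutely_continuous_from T (\- x).
  by move=> b; apply: absolutely_continuousN; exact: acx.
have dNx := flux_equationN dx.
have ndNx : forall s t, T <= s -> s <= t -> (\- x) s <= (\- x) t.
  apply: (flux_ge0_nondecreasing p0 acNx dNx) => t Tt.
  by rewrite /= oppr_ge0 ltW// y_lt0.
have nix s t : T <= s -> s <= t -> x t <= x s.
  by move=> Ts st; have := ndNx s t Ts st; rewrite /= lerN2.
have ndNy s t : T <= s -> s <= t -> (\- y) s <= (\- y) t.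
  by move=> Ts st; rewrite /= lerN2 niy.
have iQx := locally_integrable_fromM_nonincreasing iQ nix.
have ipNy := locally_integrable_fromM_nondecreasing ip ndNy.
apply: (positive_solution_nonincreasing p0 ip Q0 iQ ndNy _ nix).
- by rewrite /= oppr_gt0.
- move=> t Tt; rewrite /= opprK addrC.
  exact: supersolution_decrement acy dy QF iQx _ _ (lexx T) Tt.
- move=> s t Ts st; rewrite (le_trans (flux_increment p0 acNx dNx ipNy Ts st))//=.
  by rewrite opprK gerDr oppr_le0 ltW// x0// (le_trans Ts).
Qed.

(** [ln x] is absolutely continuous because [x] is bounded below by [x T], and its
    derivative is at least [h]. *)
Lemma ln_growth T h x : locally_absolutely_continuous_from T x ->
  (forall s t, T <= s -> s <= t -> x s <= x t) -> 0 < x T ->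
  locally_integrable_from T h ->
  {ae leb R, forall t, T <= t -> derivable x t 1 /\ h t * x t <= derive1 x t} ->
  forall s t, T <= s -> s <= t -> x s * expR (primitive s h t) <= x t.
Proof.
move=> acx ndx xT ih dx s t Ts st.
have x0 r : T <= r -> 0 < x r by move=> Tr; rewrite (lt_le_trans xT)// ndx.
have Tt := le_trans Ts st.
suff : primitive s h t <= (@ln R \o x) t - (@ln R \o x) s.
  rewrite /= -ln_div ?posrE ?x0// => H.
  rewrite mulrC -ler_pdivlMr ?x0//.
  by rewrite -[leRHS]lnK ?posrE ?divr_gt0 ?x0// ler_expR.
apply: (primitive_le_increment (T := T)) => // [b|].
- have acb : absolutely_continuous T b x by exact: acx.
  apply: (absolutely_continuous_lipschitz (K := (x T)^-1) acb) => r r' Tr rr' _ /=.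
  have xr := x0 r Tr; have xr' := x0 r' (le_trans Tr rr'); have xrr' := ndx r r' Tr rr'.
  rewrite (ger0_norm (_ : 0 <= x r' - x r)) ?subr_ge0//.
  rewrite ger0_norm ?subr_ge0 ?ler_ln ?posrE// -ln_div ?posrE//.
  have -> : x r' / x r = 1 + (x r' - x r) / x r.
    by rewrite mulrBl divff ?gt_eqF// addrC subrK.
  have d0 : 0 <= x r' - x r by rewrite subr_ge0.
  apply: (@le_trans _ _ ((x r' - x r) / x r)).
    by apply: le_ln1Dx; rewrite (@lt_le_trans _ _ 0)// ?ltrN10// divr_ge0// ltW.
  by rewrite mulrC ler_wpM2r// lef_pV2 ?posrE// ndx.
- apply: ae_lebS dx => r dr Tr; have [dxr hr] := dr (ltW Tr).
  have xr := x0 r (ltW Tr).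
  have dln := is_derive1_ln xr.
  have D := is_derive1_comp dln (derivableP dxr).
  split; first by case: D.
  rewrite derive1E (@derive_val _ _ _ _ _ _ _ D) -derive1E mulrC.
  by rewrite ler_pdivlMr.
Qed.

End Supersolutions.

(** * The equation with deviating arguments *)

Section Deviating.
Context {R : realType}.
Local Notation B := (measurableTypeR R).
Local Notation L := (lebesgueR R).

Lemma near_pinfty_from (t0 : R) (P : R -> Prop) : (\forall t \near +oo, P t) ->
  exists2 T, t0 <= T & forall t, T <= t -> P t.
Proof.
move=> [M [_ MP]]; exists (Num.max t0 (M + 1)); first by rewrite le_max lexx.
by move=> t; rewrite ge_max => /andP[_ Mt]; apply: MP; rewrite (lt_le_trans _ Mt)// ltrDl.
Qed.

Lemma locally_integrable_from_sum n (P : pred 'I_n) (h : 'I_n -> R -> R) (T : R) :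
  (forall k, P k -> locally_integrable_from T (h k)) ->
  locally_integrable_from T (fun t => \sum_(k < n | P k) h k t).
Proof.
move=> hT b.
have -> : EFin \o (fun t => \sum_(k < n | P k) h k t) =
    (fun t => \sum_(k < n | P k) (EFin \o h k) t)%E.
  by apply/funext => t; rewrite /= sumEFin.
by apply: (@integrable_sum _ L R (leb R) _ (leb_measurable_itv _)) => k /hT.
Qed.

Lemma ler_sum_sub n (P : pred 'I_n) (u w : 'I_n -> R) :
  (forall k, 0 <= w k) -> (forall k, P k -> u k <= w k) ->
  \sum_(k < n | P k) u k <= \sum_(k < n) w k.
Proof.
move=> w0 uw; rewrite big_mkcond/=; apply: ler_sum => k _.
by case: ifPn => // Pk; exact: uw.
Qed.

Lemma locally_bounded_above (t0 T b : R) (f : R -> R) : t0 <= T ->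
  locally_bounded_from t0 f -> exists A, forall t, T <= t -> t <= b -> f t <= A.
Proof.
move=> t0T /(_ b)[M [_ fM]]; exists (M + 1) => t Tt tb.
rewrite (le_trans (ler_norm _))// fM ?ltrDl//= in_itv/= tb andbT.
exact: le_trans Tt.
Qed.

(** With [H] the indefinite integral of [h], the weight is
    [exp (H (al t) - H t)], a monotone function composed with a measurable one; it
    is bounded on bounded intervals because [al] is. *)
Lemma advanced_weight_locally_integrable (T : R) (q al h : R -> R) :
  locally_integrable_from T q -> lebesgue_measurable_fun `[T, +oo[ al ->
  (forall b, exists A, forall t, T <= t -> t <= b -> al t <= A) ->
  (forall t, T <= t -> t <= al t) ->
  locally_integrable_from T h -> (forall t, T <= t -> 0 <= h t) ->
  locally_integrable_from T (fun t => q t * expR (primitive t h (al t))).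
Proof.
move=> iq mal bal tal ih h0.
pose H s := primitive T h (Num.max T s).
have ndH : {homo H : s t / s <= t}.
  move=> s t st; have Tm : T <= Num.max T s by rewrite le_max lexx.
  rewrite -subr_ge0 /H (primitiveB ih)//; last by rewrite ge_max !le_max lexx st orbT.
  apply: Rintegral_ge0 => r /=; rewrite in_itv/= => /andP[mr _].
  exact/h0/(le_trans Tm).
have H0 s : 0 <= H s.
  by apply: Rintegral_ge0 => r /=; rewrite in_itv/= => /andP[Tr _]; exact: h0.
have HE t : T <= t -> primitive t h (al t) = H (al t) - H t.
  move=> Tt; rewrite /H !max_r// ?(primitiveB ih)//; [exact: tal|].
  exact: le_trans (tal t Tt).
apply: (@eq_locally_integrable_from _ _ (fun t => q t * expR (H (al t) - H t))).
  by move=> t Tt; rewrite HE.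
apply: locally_integrable_fromM => //.
  have mH : @measurable_fun _ _ B B setT H by apply: nondecreasing_measurable.
  apply: (@measurableT_comp _ _ _ L B B (@expR R)); first exact: measurable_expR.
  apply: (@measurable_funB _ L).
    exact: (@measurableT_comp _ _ _ L B B H).
  by apply: (@measurable_funTS _ _ L B); exact: measurable_funT_leb.
move=> b; have [A hA] := bal b.
exists (expR (H A)); split; first exact: num_real.
move=> M HM t /=; rewrite in_itv/= => /andP[Tt tb].
rewrite ger0_norm ?expR_ge0// ltW// (le_lt_trans _ HM)// ler_expR.
rewrite lerBlDr (le_trans (ndH _ _ (hA t Tt tb)))// lerDl.
exact: H0.
Qed.

End Deviating.

Section Main.
Context {R : realType}.
Local Notation L := (lebesgueR R).

Lemma positive_solution_not_oscillatory (D : set R) (p Q : R -> R) (T : R) :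
  [set` `[T, +oo[] `<=` D -> positive_solution T p Q -> ~ ode_oscillatory D p Q.
Proof.
move=> TD [u [acu su u0]] osc.
have [t [Tt _ ut]] := osc T u (And3 TD acu su) T.
by have := u0 t Tt; rewrite ut ltxx.
Qed.

Lemma satisfies_fromN (T : R) (p phi F : R -> R) : satisfies_from T p phi F ->
  satisfies_from T p (\- phi) (\- F).
Proof.
move=> [psi [acpsi dphi dpsi]]; exists (\- psi); split.
- by move=> b; apply: absolutely_continuousN; exact: acpsi.
- exact: flux_equationN.
- apply: ae_lebS dpsi => t dt Tt; have [d E] := dt Tt.
  split; first exact: derivableN.
  by rewrite derive1E (deriveN d) -derive1E -opprD E oppr0.
Qed.

(** As [x] is nondecreasing, [y] loses at least [x s] times the integral of [q]
    over [[s, b]], and it cannot become negative. *)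
Lemma tail_le_flux (T : R) (x y q F : R -> R) :
  (forall t, T <= t -> 0 < x t) -> (forall s t, T <= s -> s <= t -> x s <= x t) ->
  (forall t, T <= t -> 0 <= y t) -> (forall t, T <= t -> 0 <= q t) ->
  locally_integrable_from T q -> locally_absolutely_continuous_from T y ->
  {ae leb R, forall t, T <= t -> derivable y t 1 /\ derive1 y t + F t = 0} ->
  (forall t, T <= t -> q t * x t <= F t) ->
  forall s, T <= s -> (lebint `[s, +oo[ (EFin \o q) <= (y s / x s)%:E)%E.
Proof.
move=> x0 ndx y0 q0 iq acy dy qF s Ts.
have iqs := locally_integrable_fromS Ts iq.
have iqx := locally_integrable_fromM_nondecreasing iq ndx.
apply: lebint_itvy_le.
- by apply/(@measurable_EFinP _ L); exact: locally_integrable_from_measurable iqs.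
- by move=> t st; rewrite lee_fin q0// (le_trans Ts).
move=> b sb; rewrite (lebint_primitive b iqs) lee_fin ler_pdivlMr ?x0//.
have H := supersolution_decrement acy dy qF iqx Ts sb.
have yb := y0 b (le_trans Ts sb).
suff : primitive s q b * x s <= primitive s (fun t => q t * x t) b by lra.
rewrite -lee_fin EFinM -(lebint_primitive b iqs).
rewrite -(lebint_primitive b (locally_integrable_fromS Ts iqx)).
rewrite muleC /lebint.
have mI : @measurable _ L [set` `[s, b]] := leb_measurable_itv _.
have mq : @measurable_fun _ _ L _ [set` `[s, b]] (EFin \o q).
  by have /measurable_int := iqs b.
have mqx : @measurable_fun _ _ L _ [set` `[s, b]] (EFin \o (fun t => q t * x t)).
  by have /measurable_int := locally_integrable_fromS Ts iqx b.
have ge r : [set` `[s, b]] r -> s <= r /\ T <= r.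
  by rewrite /= in_itv/= => /andP[sr _]; split => //; exact: le_trans sr.
have xs : 0 <= x s by rewrite ltW// x0.
have q0' r : [set` `[s, b]] r -> (0 <= (EFin \o q) r)%E.
  by move=> /ge[_ Tr]; rewrite lee_fin q0.
rewrite -(@ge0_integralZl_EFin _ L R (leb R) _ mI _ q0' mq _ xs).
apply: (le_lebint mI _ mqx).
- by apply: (@measurable_funeM _ L).
- by move=> r /[dup] /q0' qr rsb; rewrite mule_ge0.
- move=> r /ge[sr Tr]; rewrite /= -EFinM lee_fin mulrC ler_wpM2l ?q0//.
  exact: ndx.
Qed.

End Main.

Section Assembly.
Context {R : realType}.
Local Notation L := (lebesgueR R).

Lemma near_pinfty_forall_in n (t0 : R) (alpha : 'I_n -> R -> R)
    (Omega : set 'I_n) (P : 'I_n -> R -> Prop) :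
  (forall k, Omega k -> exists2 tk, t0 <= tk & forall t, tk <= t -> P k t) ->
  \forall t \near +oo, forall k, Omega k -> P k t.
Proof.
move=> H; apply: filter_forall => k.
have [Ok|nOk] := pselect (Omega k); last by apply: nearW => t /nOk.
have [tk _ Pk] := H k Ok.
by near=> t => _; apply: Pk; near: t; apply: nbhs_pinfty_ge; exact: num_real.
Unshelve. all: by end_near. Qed.

(** Near [+oo] all values [phi (alpha k t)] are positive, so the flux is
    nonincreasing; whichever sign it takes there, [phi] is a positive
    supersolution of one of the two ordinary equations. *)
Lemma eventually_positive_absurd n (t0 : R) (q alpha : 'I_n -> R -> R)
    (p phi : R -> R) :
  (forall k, locally_integrable_from t0 (q k)) ->
  (forall k, lebesgue_measurable_fun `[t0, +oo[ (alpha k)) ->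
  (forall k, locally_bounded_from t0 (alpha k)) ->
  (forall t, t0 <= t -> 0 < p t) ->
  locally_integrable_from t0 (fun t => 1 / p t) ->
  (forall k t, t0 <= t -> 0 <= q k t) ->
  (forall k, alpha k t @[t --> +oo] --> +oo) ->
  ode_oscillatory `[t0, +oo[ p (q_minus t0 q alpha) ->
  ode_oscillatory (q_plus_exp_dom t0 alpha) p (q_plus_exp t0 q alpha p) ->
  locally_absolutely_continuous_from t0 phi ->
  satisfies_from t0 p phi (fun t => \sum_(k < n) q k t * phi (alpha k t)) ->
  (\forall t \near +oo, 0 < phi t) -> False.
Proof.
move=> iq mal bal p0 ip q0 al_oo osc_minus osc_plus acphi [psi [acpsi dphi dpsi]] phi_pos.
pose F t := \sum_(k < n) q k t * phi (alpha k t).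
have al_ge A : \forall t \near +oo, forall k, A <= alpha k t.
  by apply: filter_forall => k; have /cvgryPge := al_oo k; exact.
have [M0 tM0 phi0] := near_pinfty_from t0 phi_pos.
have [M M0M al_M0] := near_pinfty_from M0 (al_ge M0).
have tM := le_trans tM0 M0M.
have acphiM := locally_absolutely_continuous_fromS tM acphi.
have acpsiM := locally_absolutely_continuous_fromS tM acpsi.
have restr T (P : R -> Prop) : t0 <= T -> {ae leb R, forall t, t0 <= t -> P t} ->
    {ae leb R, forall t, T <= t -> P t}.
  by move=> tT; apply: ae_lebS => t Pt Tt; apply: Pt; exact: le_trans Tt.
have term0 k t : M <= t -> 0 <= q k t * phi (alpha k t).
  move=> Mt; apply: mulr_ge0; first exact/q0/(le_trans tM).
  exact/ltW/phi0/al_M0.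
have niM : forall s t, M <= s -> s <= t -> psi t <= psi s.
  apply: (flux_nonincreasing acpsiM (restr _ _ tM dpsi)) => t Mt.
  by apply: sumr_ge0 => k _; exact: term0.
have phiM t : M <= t -> 0 < phi t by move=> Mt; exact/phi0/(le_trans M0M).
have p0T T : t0 <= T -> forall t, T <= t -> 0 < p t.
  by move=> tT t Tt; apply: p0; exact: le_trans Tt.
have q0T k T : t0 <= T -> forall t, T <= t -> 0 <= q k t.
  by move=> tT t Tt; apply: q0; exact: le_trans Tt.
(* Once the flux is negative, [phi] decreases and the delayed terms dominate. *)
have [[t1 [Mt1 psi_t1]]|psi_ge] := pselect (exists t1, M <= t1 /\ psi t1 < 0).
  have tt1 := le_trans tM Mt1.
  have acphi1 := locally_absolutely_continuous_fromS tt1 acphi.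
  have acNphi1 : locally_absolutely_continuous_from t1 (\- phi).
    by move=> b; apply: absolutely_continuousN; exact: acphi1.
  have psi_lt0 t : t1 <= t -> psi t < 0.
    by move=> t1t; exact: le_lt_trans (niM _ _ Mt1 t1t) psi_t1.
  have ndNphi : forall s t, t1 <= s -> s <= t -> (\- phi) s <= (\- phi) t.
    apply: (flux_ge0_nondecreasing (p0T _ tt1) acNphi1 (flux_equationN (restr _ _ tt1 dphi))).
    by move=> t t1t; rewrite /= oppr_ge0 ltW// psi_lt0.
  have al_le : \forall t \near +oo, forall k, Omega_minus t0 alpha k -> alpha k t <= t.
    by apply: (near_pinfty_forall_in (t0 := t0)).
  have [T t1T HT] := near_pinfty_from t1 (filterI (al_ge t1) al_le).
  have tT := le_trans tt1 t1T; have MT := le_trans Mt1 t1T.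
  apply: (positive_solution_not_oscillatory _ _ osc_minus (T := T)).
    by move=> t /=; rewrite !in_itv/= !andbT; exact: le_trans.
  apply: (positive_supersolution (F := F) (x := phi) (y := psi) (p0T _ tT)
    (locally_integrable_fromS tT ip)).
  - by move=> t Tt; apply: sumr_ge0 => k _; exact: q0T Tt.
  - by apply: locally_integrable_from_sum => k _; exact: locally_integrable_fromS (iq k).
  - exact: locally_absolutely_continuous_fromS tT acphi.
  - exact: locally_absolutely_continuous_fromS tT acpsi.
  - exact: restr dphi.
  - exact: restr dpsi.
  - by move=> t Tt; apply: phiM; exact: le_trans Tt.
  - move=> t Tt; rewrite /q_minus mulr_suml; apply: ler_sum_sub.
      by move=> k; apply: term0; exact: le_trans Tt.
    move=> k; rewrite inE => Ok; have [al1 al2] := HT t Tt.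
    apply: ler_wpM2l; first exact: q0T Tt.
    by rewrite -lerN2; apply: ndNphi (al1 k) (al2 k Ok).
  - by left; apply: psi_lt0.
have psi0 t : M <= t -> 0 <= psi t.
  by move=> Mt; rewrite leNgt; apply/negP => psit; apply: psi_ge; exists t.
have ndphi := flux_ge0_nondecreasing (p0T _ tM) acphiM (restr _ _ tM dphi) psi0.
have al_plus : \forall t \near +oo, forall k, Omega_plus t0 alpha k -> t <= alpha k t.
  by apply: (near_pinfty_forall_in (t0 := t0)).
have [T MT HT] := near_pinfty_from M (filterI (al_ge M) al_plus).
have tT := le_trans tM MT.
have acphiT := locally_absolutely_continuous_fromS tT acphi.
have acpsiT := locally_absolutely_continuous_fromS tT acpsi.
have phi0T t : T <= t -> 0 < phi t by move=> Tt; apply: phiM; exact: le_trans Tt.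
have psi0T t : T <= t -> 0 <= psi t by move=> Tt; apply: psi0; exact: le_trans Tt.
have ndphiT s t : T <= s -> s <= t -> phi s <= phi t.
  by move=> Ts; apply: ndphi; exact: le_trans Ts.
have ipT := locally_integrable_fromS tT ip.
have iq_plus : locally_integrable_from T (q_plus t0 q alpha).
  by apply: locally_integrable_from_sum => k _; exact: locally_integrable_fromS (iq k).
have q_plus0 t : T <= t -> 0 <= q_plus t0 q alpha t.
  by move=> Tt; apply: sumr_ge0 => k _; exact: q0T Tt.
have q_plus_le t : T <= t -> q_plus t0 q alpha t * phi t <= F t.
  move=> Tt; rewrite /q_plus mulr_suml; apply: ler_sum_sub.
    by move=> k; apply: term0; exact: le_trans Tt.
  move=> k; rewrite inE => Ok; have [al1 al2] := HT t Tt.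
  apply: ler_wpM2l; first exact: q0T Tt.
  exact: ndphiT (al2 k Ok).
(* From here on [phi] increases and the advanced terms dominate. *)
pose tail t := \int[leb R]_(s in `[t, +oo[) q_plus t0 q alpha s.
pose h t := 1 / p t * tail t.
have tail_le := tail_le_flux phi0T ndphiT psi0T q_plus0 iq_plus acpsiT
  (restr _ _ tT dpsi) q_plus_le.
have ge0 t x : T <= t -> [set` `[t, +oo[] x -> (0 <= (EFin \o q_plus t0 q alpha) x)%E.
  move=> Tt; rewrite /= in_itv/= andbT => tx.
  by rewrite lee_fin q_plus0// (le_trans Tt).
have lint0 t : T <= t -> (0 <= lebint `[t, +oo[ (EFin \o q_plus t0 q alpha))%E.
  by move=> Tt; apply: lebint_ge0 => x; exact: ge0.
have tailE t : T <= t -> (tail t)%:E = lebint `[t, +oo[ (EFin \o q_plus t0 q alpha).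
  move=> Tt; rewrite /tail /Rintegral fineK// ge0_fin_numE ?lint0//.
  by rewrite (le_lt_trans (tail_le t Tt))// ltry.
have tail0 t : T <= t -> 0 <= tail t by move=> Tt; rewrite -lee_fin tailE// lint0.
have tail_flux t : T <= t -> tail t * phi t <= psi t.
  by move=> Tt; rewrite -ler_pdivlMr ?phi0T// -lee_fin tailE// tail_le.
have ni_tail s t : T <= s -> s <= t -> tail t <= tail s.
  move=> Ts st; have Tt := le_trans Ts st; rewrite -lee_fin !tailE//.
  apply: subset_lebint; [exact: leb_measurable_itv..| | |].
  - apply/(@measurable_EFinP _ L); apply: locally_integrable_from_measurable.
    exact: locally_integrable_fromS iq_plus.
  - by move=> x; exact: ge0.
  - by move=> x; rewrite /= !in_itv/= !andbT; exact: le_trans.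
have ih : locally_integrable_from T h := locally_integrable_fromM_nonincreasing ipT ni_tail.
have h0 t : T <= t -> 0 <= h t.
  by move=> Tt; rewrite mulr_ge0 ?tail0// div1r invr_ge0 ltW// (p0T _ tT).
have growth := ln_growth acphiT ndphiT (phi0T _ (lexx T)) ih.
have {}growth s t : T <= s -> s <= t -> phi s * expR (primitive s h t) <= phi t.
  apply: growth; apply: ae_lebS (restr _ _ tT dphi) => r dr Tr.
  have [dphir E] := dr Tr; split => //.
  rewrite /h div1r -mulrA ler_pdivrMl ?(p0T _ tT)// E.
  exact: tail_flux.
have QE t : T <= t -> q_plus_exp t0 q alpha p t =
    \sum_(k in Omega_plus t0 alpha) q k t * expR (primitive t h (alpha k t)).
  move=> Tt; apply: eq_bigr => k; rewrite inE => Ok.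
  by rewrite /oriented_integral ((HT t Tt).2 k Ok).
apply: (positive_solution_not_oscillatory _ _ osc_plus (T := T)).
  move=> t /=; rewrite in_itv/= andbT => Tt; split; first exact: le_trans Tt.
  move=> k; rewrite inE => Ok; apply: le_trans (le_trans tT Tt) _.
  exact: (HT t Tt).2.
apply: (positive_supersolution (F := F) (x := phi) (y := psi) (p0T _ tT) ipT) => //.
- by move=> t Tt; apply: sumr_ge0 => k _; rewrite mulr_ge0 ?expR_ge0// (q0T _ _ tT).
- apply: (@eq_locally_integrable_from _ _ (fun t => \sum_(k in Omega_plus t0 alpha)
    q k t * expR (primitive t h (alpha k t)))); first by move=> t /QE.
  apply: locally_integrable_from_sum => k; rewrite inE => Ok.
  apply: advanced_weight_locally_integrable => //.
  + exact: locally_integrable_fromS (iq k).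
  + apply: (@measurable_funS _ _ L _ _ _ _ (leb_measurable_itv `[t0, +oo[)) (mal k).
    by move=> t /=; rewrite !in_itv/= !andbT; exact: le_trans.
  + by move=> b; exact: locally_bounded_above (bal k).
  + by move=> t Tt; exact: (HT t Tt).2.
- exact: restr dphi.
- exact: restr dpsi.
- move=> t Tt; rewrite QE// mulr_suml; apply: ler_sum_sub.
    by move=> k; apply: term0; exact: le_trans Tt.
  move=> k; rewrite inE => Ok; have [al1 al2] := HT t Tt.
  rewrite -mulrA; apply: ler_wpM2l; first exact: q0T Tt.
  by rewrite mulrC; apply: growth => //; exact: al2.
- by right.
Qed.

End Assembly.

Theorem theorem2p3 (R : realType) (n : nat) (t0 : R)
    (q alpha : 'I_n -> R -> R) (p : R -> R) :
  (0 < n)%N ->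
  (forall k, locally_integrable_from t0 (q k)) ->
  (forall k, lebesgue_measurable_fun `[t0, +oo[ (alpha k)) ->
  (forall k, locally_bounded_from t0 (alpha k)) ->
  (forall t, t0 <= t -> 0 < p t) ->
  locally_integrable_from t0 (fun t => 1 / p t) ->
  (forall k t, t0 <= t -> 0 <= q k t) ->
  (forall k, alpha k t @[t --> +oo] --> +oo) ->
  Omega_plus t0 alpha !=set0 ->
  Omega_minus t0 alpha !=set0 ->
  (\int[leb R]_(t in `[t0, +oo[) (q_plus t0 q alpha t)%:E < +oo)%E ->
  ode_oscillatory `[t0, +oo[ p (q_minus t0 q alpha) ->
  ode_oscillatory (q_plus_exp_dom t0 alpha) p (q_plus_exp t0 q alpha p) ->
  deviating_oscillatory t0 q alpha p.
Proof.
move=> _ iq mal bal p0 ip q0 al_oo _ _ _ osc_minus osc_plus phi [cphi acphi sphi] M.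
apply: contrapT => no_zero.
pose m := Num.max t0 M.
have ip_t0 : initial_point t0 alpha <= t0 by rewrite ge_min lexx.
have tm : t0 <= m by rewrite le_max lexx.
have phi_neq0 t : m <= t -> phi t != 0.
  move=> mt; apply/eqP => phit; apply: no_zero; exists t; split => //.
    exact: le_trans (le_trans ip_t0 tm) mt.
  by apply: le_trans mt; rewrite le_max lexx orbT.
have same_sign t : m <= t -> 0 < phi m * phi t.
  move=> mt; rewrite lt_neqAle eq_sym mulf_neq0 ?phi_neq0//=.
  rewrite leNgt; apply/negP => neg.
  have [c] : exists2 c, c \in `[m, t] & phi c = 0.
    apply: IVT => //.
      apply: continuous_subspaceW cphi => r /=.
      rewrite !in_itv/= andbT => /andP[mr _].
      exact: le_trans (le_trans ip_t0 tm) mr.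
    rewrite ge_min le_max.
    have [pm|pm|pm] := ltgtP (phi m) 0.
    - by move: neg; rewrite nmulr_rlt0// => /ltW ->; rewrite orbT.
    - by move: neg; rewrite pmulr_rlt0// => /ltW ->; rewrite orbT.
    - by have := phi_neq0 m (lexx m); rewrite pm eqxx.
  rewrite in_itv/= => /andP[mc _] phic.
  by have := phi_neq0 c mc; rewrite phic eqxx.
have near_m : \forall t \near +oo, m <= t by apply: nbhs_pinfty_ge; exact: num_real.
have absurd x := @eventually_positive_absurd R n t0 q alpha p x iq mal bal p0 ip q0 al_oo
  osc_minus osc_plus.
have [pm|pm|pm] := ltgtP (phi m) 0.
- apply: (absurd (\- phi)).
  + by move=> b; apply: absolutely_continuousN; exact: acphi.
  + have -> : (fun t => \sum_(k < n) q k t * (\- phi) (alpha k t)) =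
        \- (fun t => \sum_(k < n) q k t * phi (alpha k t)).
      by apply/funext => t; rewrite /= -sumrN; apply: eq_bigr => k _; rewrite mulrN.
    exact: satisfies_fromN.
  + apply: filterS near_m => t mt; rewrite /= oppr_gt0.
    by have := same_sign t mt; rewrite nmulr_rgt0.
- apply: (absurd phi) => //; apply: filterS near_m => t mt.
  by have := same_sign t mt; rewrite pmulr_rgt0.
- by have := phi_neq0 m (lexx m); rewrite pm eqxx.
Qed.
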